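(* Consider $\min_{x\in\mathbb{R}^d} f(x)$ with $f=\frac1n\sum_{i=1}^n f_i$ and $f_i(x)=\mathbb{E}_{\xi_i\sim\mathcal{D}_i}[f_i(x;\xi_i)]$. Assume: (i) every compressor $\mathcal{C}_i^t$ is $\alpha$-contractive with a common $\alpha\in(0,1]$; (ii) $f^{\inf}:=\inf_{x\in\mathbb{R}^d} f(x)>-\infty$; (iii) for each $i$ there is $L_i>0$ with $\|\nabla f_i(x)-\nabla f_i(y)\|\le L_i\|x-y\|$ for all $x,y\in\mathbb{R}^d$; (iv) there is $L>0$ with $\|\nabla f(x)-\nabla f(y)\|\le L\|x-y\|$ for all $x,y\in\mathbb{R}^d$; (v) for each $i$ there is $L_{h,i}>0$ with $\|\nabla^2 f_i(x)-\nabla^2 f_i(y)\|\le L_{h,i}\|x-y\|$ for all $x,y\in\mathbb{R}^d$; (vi) there is $L_h>0$ with $\|\nabla^2 f(x)-\nabla^2 f(y)\|\le L_h\|x-y\|$ for all $x,y\in\mathbb{R}^d$; (vii) for all $i$ and all $x\in\mathbb{R}^d$: $\mathbb{E}[\nabla f_i(x;\xi_i)]=\nabla f_i(x)$ and $\mathbb{E}\|\nabla f_i(x;\xi_i)-\nabla f_i(x)\|^2\le\sigma_g^2$, and also $\mathbb{E}[\nabla^2 f_i(x;\xi_i)]=\nabla^2 f_i(x)$ and $\mathbb{E}\|\nabla^2 f_i(x;\xi_i)-\nabla^2 f_i(x)\|^2\le\sigma_h^2$. Let $\gamma_0>0$ and $$\eta_t=\left(\frac{2}{t+2}\right)^{4/7},\qquad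 \gamma_t=\gamma_0\left(\frac{2}{t+2}\right)^{5/7}.$$ Then for every $T\ge1$ the iterates $\{x^t\}$ of the algorithm $\|\text{EF21-IGT}\|$ satisfy $$\mathbb{E}\big[\|\nabla f(\tilde x^T)\|\big]=\widetilde{\mathcal{O}}\left(\frac{V_0/\gamma_0+\sigma_g\left(1/\sqrt n+1/\alpha^2\right)+\gamma_0B_1+\gamma_0^2B_2}{T^{2/7}}\right),$$ where $\tilde x^T$ is chosen at random from $\{x^0,\dots,x^{T-1}\}$, equal to $x^t$ with probability $\gamma_t/\sum_{s=0}^{T-1}\gamma_s$, $B_1=L+\bar L/\alpha^2$, $B_2=L_h+\bar L_h/\alpha^2$, $\bar L=\frac1n\sum_{i=1}^nL_i$ and $\bar L_h=\frac1n\sum_{i=1}^nL_{h,i}$.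
   Context: $\|\cdot\|$ is the Euclidean norm for vectors and the spectral norm for matrices. A possibly randomized map $\mathcal{C}:\mathbb{R}^d\to\mathbb{R}^d$ is $\alpha$-contractive if $\mathbb{E}\|\mathcal{C}(v)-v\|^2\le(1-\alpha)\|v\|^2$ for all $v\in\mathbb{R}^d$. Algorithm $\|\text{EF21-IGT}\|$. Inputs: $x^0\in\mathbb{R}^d$ and $g_i^0,v_i^0\in\mathbb{R}^d$ for $i=1,\dots,n$ (deterministic), stepsizes $\gamma_t>0$, momentum parameters $\eta_t\in(0,1]$, compressors $\mathcal{C}_i^t$. For $t=0,1,2,\dots$, with $g^t=\frac1n\sum_{i=1}^n g_i^t$: $$x^{t+1}=x^t-\gamma_t\frac{g^t}{\|g^t\|},\qquad y^t=x^{t+1}+\frac{1-\eta_t}{\eta_t}(x^{t+1}-x^t),$$ $$v_i^{t+1}=(1-\eta_t)v_i^t+\eta_t\nabla f_i(y^t;\xi_i^{t+1}),\qquad g_i^{t+1}=g_i^t+\mathcal{C}_i^{t+1}(v_i^{t+1}-g_i^t).$$ If $g^t=0$, the quotient $g^t/\|g^t\|$ is read as $0$. The samples $\xi_i^{t+1}\sim\mathcal{D}_i$ are independent across clients $i$ and iterations $t$ and independent of everything generated earlier; the randomness of the compressor $\mathcal{C}_i^{t+1}$ is fresh, i.e. independent of its input and of the past. $\displaystyle V_0=f(x^0)-f^{\inf}+\frac{2\gamma_0}{1-\sqrt{1-\alpha}}\cdot\frac1n\sum_{i=1}^n\|g_i^0-v_i^0\|+\frac{2\gamma_0\sqrt{1-\alpha}}{1-\sqrt{1-\alpha}}\cdot\frac1n\sum_{i=1}^n\|v_i^0-\nabla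 f_i(x^0)\|.$ $A_T=\widetilde{\mathcal{O}}(B_T)$ means that there are universal numerical constants $C>0$, $p\ge0$ (independent of the problem, of the algorithm's inputs, and of $T$) such that $A_T\le C(1+\log(T+1))^pB_T$ for all $T\ge1$. The functions $f_i$ and $f_i(\cdot;\xi_i)$ are as smooth as needed for the gradients and Hessians that appear to exist. *)

(* Defs.v *)
From HB Require Import structures.
From mathcomp Require Import all_boot all_order all_algebra.
From mathcomp Require Import all_classical all_reals all_analysis.
Set Implicit Arguments.
Unset Strict Implicit.
Unset Printing Implicit Defensive.
Import Order.TTheory GRing.Theory Num.Theory.
Import numFieldNormedType.Exports.
Local Open Scope classical_set_scope.
Local Open Scope ring_scope.

(** The Borel sigma-algebra of R^d, presented as the one generated by the
    coordinate maps. *)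
Section measurable_rV.
Context {R : realType} (d : nat).

Let coord (i : 'I_d) (v : 'rV[R]_d) : R := v ord0 i.

Let rV_set0 : g_sigma_preimage coord set0.
Proof. exact: sigma_algebra0. Qed.

Let rV_setC A : g_sigma_preimage coord A -> g_sigma_preimage coord (~` A).
Proof. exact: sigma_algebraC. Qed.

Let rV_bigcup (A : (set 'rV[R]_d)^nat) : (forall k, g_sigma_preimage coord (A k)) ->
  g_sigma_preimage coord (\bigcup_k A k).
Proof. exact: sigma_algebra_bigcup. Qed.

HB.instance Definition _ := @isMeasurable.Build default_measure_display
  'rV[R]_d (g_sigma_preimage coord) rV_set0 rV_setC rV_bigcup.

End measurable_rV.

Section euclidean.
Context {R : realType} {d : nat}.
Implicit Types (u x : 'rV[R]_d) (A : 'M[R]_d).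

(** The library norm of a matrix is the maximum of its entries, hence the
    explicit Euclidean and spectral norms.  The latter acts on row vectors, which
    is immaterial as the operator norm is invariant under transposition. *)
Definition enorm u : R := Num.sqrt (\sum_j u ord0 j ^+ 2).

Definition specnorm A : R := sup [set enorm (u *m A) | u in [set u | enorm u <= 1]].

Definition grad (h : 'rV[R]_d -> R) x : 'rV[R]_d := \row_j 'D_(delta_mx ord0 j) h x.

Definition hess (h : 'rV[R]_d -> R) x : 'M[R]_d := 'J (grad h) x.

Definition twice_differentiable (h : 'rV[R]_d -> R) : Prop :=
  forall x, differentiable h x /\ differentiable (grad h) x.

End euclidean.

Section probability_notions.
Context {dO : measure_display} {Om : measurableType dO} {R : realType}.
Implicit Types (P : probability Om R) (F G : set (set Om)).

(** Entrywise expectation of a random matrix.  The library integral takes a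
    finite value on a measurable function only if it is integrable, so
    integrability is part of the statement. *)
Definition has_mean P m n (M : Om -> 'M[R]_(m, n)) (A : 'M[R]_(m, n)) : Prop :=
  forall i j, ('E_P[fun w => M w i j] = (A i j)%:E)%E.

Definition sigma_of d' (T : measurableType d') (X : Om -> T) : set (set Om) :=
  preimage_set_system setT X measurable.

Definition independent2 P F G : Prop :=
  forall A B, F A -> G B -> (P (A `&` B) = P A * P B)%E.

Definition mutually_independent P (I : finType) (F : I -> set (set Om)) : Prop :=
  forall (J : {set I}) (E : I -> set Om), (forall i, i \in J -> F i (E i)) ->
    (P (\bigcap_(i in [set` J]) E i) = \prod_(i in J) P (E i))%E.

Definition contractive P d (alpha : R) (C : Om -> 'rV[R]_d -> 'rV[R]_d) : Prop :=
  forall v, ('E_P[fun w => (enorm (C w v - v) ^+ 2)%R] <=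
             ((1 - alpha) * enorm v ^+ 2)%:E)%E.

End probability_notions.

(** A randomized compressor is a measurable function of a random seed and of its
    input: client [i] uses [Cmp i t (zeta i t)] in round [t].  Samples and seeds
    are indexed by the rounds [1, 2, ...]; the values at index 0 are never used. *)
Section randomness.
Context {dO dX dZ : measure_display} {Om : measurableType dO} {R : realType}.
Context (P : probability Om R) (n : nat).
Context (Xi : 'I_n -> measurableType dX) (Z : 'I_n -> nat -> measurableType dZ).
Context (D : forall i, probability (Xi i) R).
Context (xi : forall i, nat -> {RV P >-> Xi i}).
Context (zeta : forall i t, {RV P >-> Z i t}).

(** Generated by the samples up to round [a] and the seeds up to round [b]. *)
Definition history (a b : nat) : set (set Om) :=
  <<s [set A | (exists i s, (0 < s <= a)%N /\ sigma_of (xi i s) A) \/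
               (exists i s, (0 < s <= b)%N /\ sigma_of (zeta i s) A)] >>.

(** Together with the past as one more member of the family ([None]), the
    samples of a round are mutually independent. *)
Definition fresh_samples : Prop :=
  (forall i t A, measurable A -> distribution P (xi i t.+1) A = D i A) /\
  (forall t, mutually_independent P (fun o : option 'I_n =>
     if o is Some i then sigma_of (xi i t.+1) else history t t)).

(** Seeds of different clients in the same round may be dependent. *)
Definition fresh_compressors : Prop :=
  forall i t, independent2 P (sigma_of (zeta i t.+1)) (history t.+1 t).

End randomness.

Section algorithm.
Context {R : realType} {d n : nat}.

Definition avg (u : 'I_n -> 'rV[R]_d) : 'rV[R]_d := n%:R^-1 *: \sum_i u i.

(** Equal to 0 at [u = 0]. *)
Definition normalize (u : 'rV[R]_d) : 'rV[R]_d := (enorm u)^-1 *: u.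

Record state := State {
  st_x : 'rV[R]_d ;
  st_g : 'I_n -> 'rV[R]_d ;
  st_v : 'I_n -> 'rV[R]_d }.

Context (Xi : 'I_n -> Type) (Z : 'I_n -> nat -> Type).
Context (F : forall i, 'rV[R]_d -> Xi i -> R).
Context (Cmp : forall i t, Z i t -> 'rV[R]_d -> 'rV[R]_d).
Context (gamma eta : nat -> R).
Context (x0 : 'rV[R]_d) (g0 v0 : 'I_n -> 'rV[R]_d).

Definition ef21_igt_step (xi : forall i, nat -> Xi i) (zeta : forall i t, Z i t)
    (t : nat) (s : state) : state :=
  let x' := st_x s - gamma t *: normalize (avg (st_g s)) in
  let y := x' + ((1 - eta t) / eta t) *: (x' - st_x s) in
  let v' i := (1 - eta t) *: st_v s i
              + eta t *: grad (fun x => F x (xi i t.+1)) y in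
  let g' i := st_g s i + Cmp (zeta i t.+1) (v' i - st_g s i) in
  State x' g' v'.

Fixpoint ef21_igt (xi : forall i, nat -> Xi i) (zeta : forall i t, Z i t)
    (t : nat) : state :=
  if t is t'.+1 then ef21_igt_step xi zeta t' (ef21_igt xi zeta t')
  else State x0 g0 v0.

End algorithm.

Definition V_init (R : realType) (d n : nat) (f : 'rV[R]_d -> R)
    (fi : 'I_n -> 'rV[R]_d -> R) (alpha gamma0 : R)
    (x0 : 'rV[R]_d) (g0 v0 : 'I_n -> 'rV[R]_d) : R :=
  let q := Num.sqrt (1 - alpha) in
  f x0 - inf (range f)
  + 2 * gamma0 / (1 - q) * (n%:R^-1 * \sum_i enorm (g0 i - v0 i))
  + 2 * gamma0 * q / (1 - q) * (n%:R^-1 * \sum_i enorm (v0 i - grad (fi i) x0)).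

(* Main.v *)
Require Import Defs.
From HB Require Import structures.
From mathcomp Require Import all_boot all_order all_algebra.
From mathcomp Require Import all_classical all_reals all_analysis.
From mathcomp Require Import measurable_realfun ring lra.
Set Implicit Arguments.
Unset Strict Implicit.
Unset Printing Implicit Defensive.
Import Order.TTheory GRing.Theory Num.Theory.
Import numFieldNormedType.Exports.
Local Open Scope classical_set_scope.
Local Open Scope ring_scope.

(** Writing [v_i - grad f_i (x)] as the sum of a noise part [M_i], with
[M_i' = (1 - eta) M_i + eta (stochastic gradient - gradient at y)], and a remainder
[N_i], the extrapolation point [y] makes the first order Taylor terms in [N_i] cancel,
so that [|N_i'| <= (1 - eta) |N_i| + L_{h,i} gamma^2 / eta] pointwise.  By independence
the noise terms are orthogonal, hence [E|M_i'|^2 <= (1 - eta)^2 E|M_i|^2 + eta^2 sg^2],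
with an additional factor [1 / n] for the average over the clients.  Since [eta 0 = 1]
these recursions forget the initial values, and for the given schedules they are
solved by [|N_i| <= 2 L_{h,i} gamma0^2 b^2] and [E|M_i|^2 <= 2 sg^2 b^4], where
[b_t = (2 / (t + 2))^(1/7)].

The compression error satisfies
[E|g_i' - v_i'| <= q (E|g_i - v_i| + E|v_i' - v_i|)], with [q = sqrt (1 - alpha)], and
[1 / (1 - q) <= 2 / alpha]; summing it against the decreasing stepsizes gives the
initial terms of [V0] and the [1 / alpha^2] terms.  The normalized descent inequality
[gamma |grad f (x)| <= f (x) - f (x') + 2 gamma |g - grad f (x)| + L gamma^2] then turns
these error bounds into a bound on [sum_t gamma_t E|grad f (x_t)|], and
[sum_(t < T) gamma_t >= gamma0 T^(2/7)]. *)

(** * Euclidean geometry and calculus *)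

(** The exponents come from a balance. The steady state of the variance recursion has size [eta],
    hence standard deviation [b^2]; the steady state of the bias recursion has size
    [gamma^2 / eta^2], again [b^2] up to [gamma0^2]. Weighted by [gamma], both errors become
    multiples of [b^7 = 2 / (t + 2)], whose sum is logarithmic. The samples of a round are mutually
    independent, whereas the seeds of different clients may be dependent. The gain [1 / sqrt n] is
    therefore taken from the averaged noise alone, and compression errors are bounded client by
    client, in first moment. Conditional expectations are replaced by Fubini on the law of a pair of
    independent variables: the fresh variable is integrated out while the past is frozen. This
    requires knowing which part of the history each iterate depends on. The history has two counters
    because, at the moment of compression, the samples of the round have been drawn and its seeds
    have not. *)

Section euclidean_geometry.
Context {R : realType} {d : nat}.
Implicit Types (u v w : 'rV[R]_d) (a c : R) (A : 'M[R]_d).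

Definition dotp u v : R := \sum_j u ord0 j * v ord0 j.

Lemma dotpC u v : dotp u v = dotp v u.
Proof. by apply: eq_bigr => j _; rewrite mulrC. Qed.

Lemma dotpDl u v w : dotp (u + v) w = dotp u w + dotp v w.
Proof.
by rewrite /dotp -big_split; apply: eq_bigr => j _; rewrite mxE mulrDl.
Qed.

Lemma dotpZl a u v : dotp (a *: u) v = a * dotp u v.
Proof.
by rewrite /dotp mulr_sumr; apply: eq_bigr => j _; rewrite mxE mulrA.
Qed.

Lemma dotpNl u v : dotp (- u) v = - dotp u v.
Proof. by rewrite -scaleN1r dotpZl mulN1r. Qed.

Lemma dotpBl u v w : dotp (u - v) w = dotp u w - dotp v w.
Proof. by rewrite dotpDl dotpNl. Qed.

Lemma dotpDr u v w : dotp w (u + v) = dotp w u + dotp w v.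
Proof. by rewrite dotpC dotpDl !(dotpC w). Qed.

Lemma dotpBr u v w : dotp w (u - v) = dotp w u - dotp w v.
Proof. by rewrite dotpC dotpBl !(dotpC w). Qed.

Lemma dotpZr a u v : dotp u (a *: v) = a * dotp u v.
Proof. by rewrite dotpC dotpZl dotpC. Qed.

Lemma enorm_ge0 u : 0 <= enorm u.
Proof. exact: sqrtr_ge0. Qed.

Lemma enorm_sqr u : enorm u ^+ 2 = dotp u u.
Proof. by rewrite sqr_sqrtr// sumr_ge0// => j _; rewrite sqr_ge0. Qed.

Lemma enorm0 : enorm (0 : 'rV[R]_d) = 0.
Proof.
by rewrite /enorm big1 ?sqrtr0// => j _; rewrite mxE expr0n.
Qed.

Lemma enormZ a u : enorm (a *: u) = `|a| * enorm u.
Proof.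
rewrite /enorm -sqrtr_sqr -sqrtrM ?sqr_ge0//; congr Num.sqrt.
by rewrite mulr_sumr; apply: eq_bigr => j _; rewrite mxE exprMn.
Qed.

Lemma enormN u : enorm (- u) = enorm u.
Proof. by rewrite -scaleN1r enormZ normrN1 mul1r. Qed.

Lemma enormC u v : enorm (u - v) = enorm (v - u).
Proof. by rewrite -enormN opprB. Qed.

Lemma enorm_sqrD u v :
  enorm (u + v) ^+ 2 = enorm u ^+ 2 + 2 * dotp u v + enorm v ^+ 2.
Proof. rewrite !enorm_sqr !dotpDl !dotpDr (dotpC v u); ring. Qed.

Lemma dotp_enorm_eq0 u v : enorm u = 0 -> dotp u v = 0.
Proof.
move=> u0; apply: big1 => j _; suff -> : u ord0 j = 0 by rewrite mul0r.
have : dotp u u == 0 by rewrite -enorm_sqr u0 expr0n.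
rewrite psumr_eq0 => [/allP/(_ j)|k _]; last by rewrite -expr2 sqr_ge0.
by rewrite mem_index_enum -expr2 sqrf_eq0 => /(_ isT)/eqP.
Qed.

Lemma dotp_le u v : dotp u v <= enorm u * enorm v.
Proof.
have [u0|u0] := eqVneq (enorm u) 0; first by rewrite dotp_enorm_eq0// u0 mul0r.
have [v0|v0] := eqVneq (enorm v) 0.
  by rewrite dotpC dotp_enorm_eq0// v0 mulr0.
have up : 0 < enorm u by rewrite lt0r u0 enorm_ge0.
have vp : 0 < enorm v by rewrite lt0r v0 enorm_ge0.
(* Expanding this square gives [2 |u| |v| (|u| |v| - <u, v>) >= 0]. *)
have := sqr_ge0 (enorm (enorm v *: u - enorm u *: v)).
rewrite enorm_sqrD enormN !enormZ !ger0_norm ?enorm_ge0// -scaleNr dotpZl dotpZr.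
by move=> h; rewrite -(ler_pM2l (mulr_gt0 up vp)); lra.
Qed.

Lemma ler_enormD u v : enorm (u + v) <= enorm u + enorm v.
Proof.
rewrite -(@ler_pXn2r _ 2) ?nnegrE ?addr_ge0 ?enorm_ge0// enorm_sqrD.
by have := dotp_le u v; rewrite sqrrD -mulr_natl; lra.
Qed.

Lemma ler_enormB u v : enorm (u - v) <= enorm u + enorm v.
Proof. by rewrite -(enormN v) ler_enormD. Qed.

Lemma ler_enorm_sum (I : Type) (r : seq I) (F : I -> 'rV[R]_d) :
  enorm (\sum_(i <- r) F i) <= \sum_(i <- r) enorm (F i).
Proof.
elim: r => [|i r IH]; first by rewrite !big_nil enorm0.
by rewrite !big_cons (le_trans (ler_enormD _ _))// lerD2l.
Qed.

Lemma dotp_normalize u : dotp u (normalize u) = enorm u.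
Proof.
rewrite /normalize dotpZr -enorm_sqr expr2.
have [->|u0] := eqVneq (enorm u) 0; first by rewrite !mulr0.
by rewrite mulKf.
Qed.

Lemma enorm_normalize_le1 u : enorm (normalize u) <= 1.
Proof.
rewrite /normalize enormZ ger0_norm ?invr_ge0 ?enorm_ge0//.
have [->|u0] := eqVneq (enorm u) 0; first by rewrite mulr0.
by rewrite mulVf.
Qed.

(** Reduces a norm bound to a bound on a scalar, which the mean value theorem can supply. *)
Lemma enorm_le_of_dotp u a : dotp u u <= enorm u * a -> 0 <= a -> enorm u <= a.
Proof.
rewrite -enorm_sqr expr2 => + a0.
have [->//|u0] := eqVneq (enorm u) 0.
by rewrite ler_pM2l// lt0r u0 enorm_ge0.
Qed.

Lemma enorm_entry_le u j : `|u ord0 j| <= enorm u.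
Proof.
rewrite -(@ler_pXn2r _ 2) ?nnegrE ?enorm_ge0// real_normK ?num_real//.
rewrite enorm_sqr /dotp (bigD1 j)//= -expr2 lerDl sumr_ge0// => k _.
by rewrite -expr2 sqr_ge0.
Qed.

(** [sup] dominates a set only if that set is bounded. The sum of the row norms is a bound because
    the entries of [u] are at most 1 in absolute value. *)
Lemma specnorm_ubound A :
  has_ubound [set enorm (u *m A) | u in [set u | enorm u <= 1]].
Proof.
exists (\sum_i enorm (row i A)) => _ [u /= u1 <-].
rewrite mulmx_sum_row (le_trans (ler_enorm_sum _ _))// ler_sum// => i _.
rewrite enormZ ler_piMl ?enorm_ge0//.
exact: le_trans (enorm_entry_le _ _) u1.
Qed.

Lemma enorm_mulmx_le A u : enorm (u *m A) <= specnorm A * enorm u.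
Proof.
have [u0|u0] := eqVneq (enorm u) 0.
  have -> : u = 0.
    apply/rowP => j; rewrite mxE; apply/eqP; rewrite -normr_le0 -u0.
    exact: enorm_entry_le.
  by rewrite mul0mx enorm0 mulr0.
have up : 0 < enorm u by rewrite lt0r u0 enorm_ge0.
have := enorm_normalize_le1 u; rewrite -ler_pdivrMr// => nu.
have -> : enorm (u *m A) / enorm u = enorm (normalize u *m A).
  by rewrite /normalize -scalemxAl enormZ ger0_norm ?invr_ge0 ?enorm_ge0// mulrC.
by apply: ub_le_sup; [exact: specnorm_ubound|exists (normalize u)].
Qed.

End euclidean_geometry.

(** * Mean value theorem, Taylor estimates and the descent inequality *)

Section calculus.
Context {R : realType} {d : nat}.
Implicit Types (x u v : 'rV[R]_d) (h : 'rV[R]_d -> R).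

Lemma derive_dotp_grad h x v : differentiable h x -> 'D_v h x = dotp (grad h x) v.
Proof.
move=> dh; rewrite deriveE// {1}(row_sum_delta v) linear_sum; apply: eq_bigr.
by move=> j _; rewrite linearZ mxE deriveE// mulrC.
Qed.

Lemma is_derive_line h x v (s : R) : derivable h (x + s *: v) v ->
  is_derive s (1 : R) (fun s : R => h (x + s *: v)) ('D_v h (x + s *: v)).
Proof.
have e : (fun k : R => k^-1 *: (h (x + (k *: 1 + s) *: v) - h (x + s *: v))) =
         (fun k : R => k^-1 *: (h (k *: v + (x + s *: v)) - h (x + s *: v))).
  apply/funext => k; congr (_ *: (h _ - _)).
  by rewrite [k%:A](mulr1) scalerDl addrCA.
by move=> dh; apply: DeriveDef; [rewrite /derivable e|rewrite /derive e].
Qed.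

Lemma line_MVT h x v : (forall y, derivable h y v) ->
  exists2 s : R, 0 < s < 1 & h (x + v) - h x = 'D_v h (x + s *: v).
Proof.
move=> dh; have der (s : R) : is_derive s (1 : R) (fun s : R => h (x + s *: v)) ('D_v h (x + s *: v)).
  exact: is_derive_line.
have cont : {within `[0, 1], continuous (fun s : R => h (x + s *: v))}.
  by apply: derivable_within_continuous => s _; have [] := der s.
have [s] := MVT ltr01 (fun s _ => der s) cont.
rewrite in_itv/= scale1r scale0r addr0 subr0 mulr1 => s01 ->; by exists s.
Qed.

(** A single intermediate point gives [L] where integration along the segment would give [L / 2];
    only numerical constants are affected. *)
Lemma smooth_upper_bound h (L : R) x v : 0 <= L -> (forall y, differentiable h y) ->
  (forall y z, enorm (grad h y - grad h z) <= L * enorm (y - z)) ->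
  h (x + v) <= h x + dotp (grad h x) v + L * enorm v ^+ 2.
Proof.
move=> L0 dh lip; have [|s /andP[s0 s1]] := @line_MVT h x v.
  by move=> y; exact: diff_derivable.
rewrite derive_dotp_grad// -(subrK (grad h x) (grad h _)) dotpDl.
suff : dotp (grad h (x + s *: v) - grad h x) v <= L * enorm v ^+ 2 by lra.
apply: le_trans (dotp_le _ _) _; rewrite expr2 mulrA ler_wpM2r ?enorm_ge0//.
apply: le_trans (lip _ _) _; rewrite ler_wpM2l// addrAC subrr add0r enormZ.
by rewrite gtr0_norm// ler_piMl ?enorm_ge0// ltW.
Qed.

Lemma derive_dotp (G : 'rV[R]_d -> 'rV[R]_d) u x v : derivable G x v ->
  is_derive x v (fun y => dotp u (G y)) (dotp u ('D_v G x)).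
Proof.
move=> dG; have dGj j : is_derive x v (u ord0 j \*: (fun y => G y ord0 j))
    (u ord0 j *: 'D_v (fun y => G y ord0 j) x).
  by apply/is_deriveZ/derivableP; exact: (derivable_mxP _ _ _).1 dG ord0 j.
have := @is_derive_sum _ _ _ _ _ x v _ dGj.
have -> : \sum_(j < d) (u ord0 j \*: (fun y => G y ord0 j)) = (fun y => dotp u (G y)).
  by apply/funext => y; rewrite fct_sumE.
rewrite (_ : \sum_(j < d) _ = dotp u ('D_v G x))// derive_mx//.
by apply: eq_bigr => j _; rewrite mxE.
Qed.

(** The mean value theorem fails for vector-valued maps, so it is applied to the scalar function
    [y |-> <u, grad h y>] with [u] the remainder itself. Cauchy-Schwarz then leaves one factor [|u|]
    to cancel. *)
Lemma grad_taylor h (Lh : R) x v : 0 <= Lh -> twice_differentiable h ->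
  (forall y z, specnorm (hess h y - hess h z) <= Lh * enorm (y - z)) ->
  enorm (grad h (x + v) - grad h x - v *m hess h x) <= Lh * enorm v ^+ 2.
Proof.
move=> L0 dh lip.
have [u uE] : exists u, u = grad h (x + v) - grad h x - v *m hess h x by eexists.
rewrite -uE; have dgrad y : derivable (grad h) y v by apply: diff_derivable; have [] := dh y.
apply: enorm_le_of_dotp; last by rewrite mulr_ge0// exprn_ge0// enorm_ge0.
have [y|s /andP[s0 s1]] := @line_MVT (fun y => dotp u (grad h y)) x v.
  by have [] := derive_dotp u (dgrad y).
have [_ ->] := derive_dotp u (dgrad (x + s *: v)).
rewrite deriveEjacobian; last by have [] := dh (x + s *: v).
rewrite -/(hess h _) => e.
have -> : dotp u u = dotp u (v *m (hess h (x + s *: v) - hess h x)).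
  by rewrite {2}uE !dotpBr e mulmxBr dotpBr.
apply: le_trans (dotp_le _ _) _; rewrite ler_wpM2l ?enorm_ge0//.
apply: le_trans (enorm_mulmx_le _ _) _.
rewrite expr2 mulrA ler_wpM2r ?enorm_ge0//; apply: le_trans (lip _ _) _.
rewrite addrAC subrr add0r enormZ gtr0_norm// ler_wpM2l//.
by rewrite ler_piMl ?enorm_ge0// ltW.
Qed.

(** Since [|normalize g| <= 1], one has [<grad h x, normalize g> >= |g| - |g - grad h x| >= |grad h
    x| - 2 |g - grad h x|], whence the factor 2. The case [g = 0] is covered, as
    [<g, normalize g> = |g|] still holds. *)
Lemma normalized_descent h (L gam : R) x g : 0 <= L -> 0 <= gam ->
  (forall y, differentiable h y) ->
  (forall y z, enorm (grad h y - grad h z) <= L * enorm (y - z)) ->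
  gam * enorm (grad h x) <= h x - h (x - gam *: normalize g)
    + 2 * gam * enorm (g - grad h x) + L * gam ^+ 2.
Proof.
move=> L0 g0 dh lip.
have := smooth_upper_bound x (- (gam *: normalize g)) L0 dh lip.
rewrite enormN enormZ (ger0_norm g0) dotpC dotpNl dotpZl (dotpC _ (grad h x)).
rewrite exprMn => ub.
have n1 : enorm (normalize g) ^+ 2 <= 1.
  by rewrite expr_le1// ?enorm_ge0// enorm_normalize_le1.
have {}n1 : L * (gam ^+ 2 * enorm (normalize g) ^+ 2) <= L * gam ^+ 2.
  by rewrite ler_wpM2l// ler_piMr// sqr_ge0.
have e1 : dotp (grad h x) (normalize g) >= enorm g - enorm (g - grad h x).
  have -> : dotp (grad h x) (normalize g) = enorm g - dotp (g - grad h x) (normalize g).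
    by rewrite dotpBl dotp_normalize opprB addrC subrK.
  rewrite lerD2l lerN2; apply: le_trans (dotp_le _ _) _.
  by rewrite ler_piMr ?enorm_ge0// enorm_normalize_le1.
have e2 : enorm (grad h x) <= enorm g + enorm (g - grad h x).
  by rewrite -[grad h x](subKr g); apply: le_trans (ler_enormB _ _) _; rewrite subKr.
have e3 : gam * enorm (grad h x) <=
    gam * (dotp (grad h x) (normalize g) + 2 * enorm (g - grad h x)).
  by rewrite ler_wpM2l//; lra.
by lra.
Qed.

(* The weights of the transport step are chosen so that the first order terms
   of both Taylor expansions at [x'] cancel. *)
Lemma transport_remainder h (Lh eta : R) x x' : 0 <= Lh -> 0 < eta <= 1 ->
  twice_differentiable h ->
  (forall y z, specnorm (hess h y - hess h z) <= Lh * enorm (y - z)) ->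
  enorm ((1 - eta) *: grad h x
         + eta *: grad h (x' + ((1 - eta) / eta) *: (x' - x)) - grad h x')
    <= Lh * (enorm (x' - x) ^+ 2 / eta).
Proof.
move=> L0 /andP[e0 e1] dh lip; set c := (1 - eta) / eta; set v := x' - x.
have c0 : 0 <= c by rewrite divr_ge0 ?subr_ge0// ltW.
have ec : eta * c = 1 - eta by rewrite /c mulrCA divff ?mulr1// gt_eqF.
pose Z w := grad h (x' + w) - grad h x' - w *m hess h x'.
have -> : (1 - eta) *: grad h x + eta *: grad h (x' + c *: v) - grad h x' =
    (1 - eta) *: Z (- v) + eta *: Z (c *: v).
  rewrite /Z subKr mulNmx -scalemxAl.
  move: (grad h x) (grad h _) (grad h x') (v *m _) => p q r k.
  apply/rowP => j; rewrite !mxE.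
  have : eta * (c * k ord0 j) = (1 - eta) * k ord0 j by rewrite mulrA ec.
  by lra.
apply: le_trans (ler_enormD _ _) _; rewrite !enormZ !ger0_norm ?subr_ge0// ?(ltW e0)//.
have Z1 := grad_taylor x' (- v) L0 dh lip.
have Z2 := grad_taylor x' (c *: v) L0 dh lip.
rewrite -/(Z _) enormN in Z1; rewrite -/(Z _) enormZ ger0_norm// in Z2.
have l1 : (1 - eta) * enorm (Z (- v)) <= (1 - eta) * (Lh * enorm v ^+ 2).
  by rewrite ler_wpM2l// subr_ge0.
have l2 : eta * enorm (Z (c *: v)) <= eta * (Lh * (c * enorm v) ^+ 2).
  by rewrite ler_wpM2l// ltW.
apply: le_trans (lerD l1 l2) _.
(* By [eta * c = 1 - eta] the second remainder bound is [c] times the first, and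
   [1 + c = 1 / eta]. *)
have -> : eta * (Lh * (c * enorm v) ^+ 2) = (1 - eta) * (Lh * enorm v ^+ 2) * c.
  by rewrite -ec; ring.
have -> : Lh * (enorm v ^+ 2 / eta) = Lh * enorm v ^+ 2 * (1 + c).
  by rewrite /c; field; rewrite gt_eqF.
rewrite -[X in X + _ <= _]mulr1 -mulrDr ler_wpM2r ?addr_ge0//.
by rewrite ler_piMl ?mulr_ge0 ?enorm_ge0//; lra.
Qed.

Lemma ler_enorm_avg n (u : 'I_n -> 'rV[R]_d) :
  enorm (avg u) <= n%:R^-1 * \sum_i enorm (u i).
Proof.
rewrite /avg enormZ ger0_norm ?invr_ge0 ?ler0n// ler_wpM2l ?invr_ge0 ?ler0n//.
exact: ler_enorm_sum.
Qed.

(** Convertible to the [f] of the theorem, so hypotheses about [f] apply to it directly. *)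
Definition average_of n (fi : 'I_n -> 'rV[R]_d -> R) (x : 'rV[R]_d) : R :=
  n%:R^-1 * \sum_i fi i x.

Let average_ofE n (fi : 'I_n -> 'rV[R]_d -> R) :
  average_of fi = (n%:R^-1 : R) *: (\sum_i fi i).
Proof. by apply/funext => x; rewrite /average_of fct_sumE. Qed.

Lemma differentiable_average n (fi : 'I_n -> 'rV[R]_d -> R) x :
  (forall i, differentiable (fi i) x) -> differentiable (average_of fi) x.
Proof.
by move=> dfi; rewrite average_ofE; apply: differentiableZ; exact: differentiable_sum.
Qed.

Lemma grad_average n (fi : 'I_n -> 'rV[R]_d -> R) x :
  (forall i, differentiable (fi i) x) ->
  grad (average_of fi) x = avg (fun i => grad (fi i) x).
Proof.
move=> dfi; apply/rowP => j; rewrite !mxE summxE average_ofE.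
have der i : derivable (fi i) x (delta_mx ord0 j) by exact: diff_derivable.
rewrite (deriveZ (f := \sum_i fi i)); last exact: derivable_sum.
rewrite derive_sum//; congr (_ * _).
by apply: eq_bigr => i _; rewrite mxE.
Qed.

End calculus.

(** * Step sizes *)

Section schedule.
Context {R : realType}.

(* [eta t = schedule t ^+ 4] and [gamma t = gamma0 * schedule t ^+ 5], so that all
   rates become integer powers of one quantity, with [schedule t ^+ 7] summing up
   to a logarithm. *)
Definition schedule (t : nat) : R := (2 / (t%:R + 2)) `^ (1 / 7).
Local Notation b := schedule.

Lemma powR_schedule t n : (2 / (t%:R + 2) : R) `^ (n%:R / 7) = b t ^+ n.
Proof.
by rewrite -powR_mulrn ?powR_ge0// /schedule -powRrM mul1r (mulrC 7^-1).
Qed.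

Lemma schedule_expr7 t : b t ^+ 7 = 2 / (t%:R + 2).
Proof. by rewrite -powR_schedule divff ?pnatr_eq0// powRr1// divr_ge0. Qed.

Lemma schedule_gt0 t : 0 < b t.
Proof. by rewrite powR_gt0// divr_gt0// ltr_wpDl// ltr0n. Qed.

Lemma schedule_ge0 t : 0 <= b t. Proof. exact: ltW (schedule_gt0 t). Qed.

Lemma schedule_le1 t : b t <= 1.
Proof.
have <- : 1 `^ (1 / 7) = 1 :> R by rewrite powR1.
by rewrite ge0_ler_powR ?nnegrE ?divr_ge0// ler_pdivrMr ?ltr_wpDl// mul1r lerDr.
Qed.

Lemma schedule0 : b 0 = 1.
Proof. by rewrite /schedule add0r divff ?pnatr_eq0// powR1. Qed.

Lemma schedule_exp_le t m n : (m <= n)%N -> b t ^+ n <= b t ^+ m.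
Proof. by move=> mn; rewrite ler_wiXn2l ?schedule_ge0 ?schedule_le1. Qed.

Lemma schedule_nincr s t : (s <= t)%N -> b t <= b s.
Proof.
move=> st; rewrite ge0_ler_powR ?nnegrE ?divr_ge0// ler_pM2l//.
by rewrite lef_pV2 ?posrE ?ltr_wpDl// lerD2r ler_nat.
Qed.

(** The ratio [c = b t.+1 / b t] satisfies [c^7 = 1 - 1 / (t + 3) >= 1 - b t^7 / 2 >= 1 - b t^4 /
    2], and [c^n >= c^7] because [c <= 1]. The rates thus lose at most half of the contraction [eta]
    per round, which leaves the other half for new errors. *)
Lemma schedule_step t n : (n <= 7)%N ->
  b t ^+ n * (1 - b t ^+ 4 / 2) <= b t.+1 ^+ n.
Proof.
move=> n7; have t2 : (0 : R) < t%:R + 2 by rewrite ltr_wpDl.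
have t3 : (0 : R) < t.+1%:R + 2 by rewrite ltr_wpDl.
pose c := b t.+1 / b t; have bc : b t.+1 = b t * c.
  by rewrite /c mulrCA divff ?mulr1// gt_eqF ?schedule_gt0.
have c0 : 0 <= c by rewrite divr_ge0 ?schedule_ge0.
have c1 : c <= 1.
  by rewrite ler_pdivrMr ?schedule_gt0// mul1r schedule_nincr.
have c7 : c ^+ 7 = 1 - (t%:R + 3)^-1.
  rewrite /c expr_div_n !schedule_expr7 -natr1.
  have t0 : (0 : R) <= t%:R by rewrite ler0n.
  by field; rewrite ?gt_eqF//; lra.
have c7n : c ^+ 7 <= c ^+ n by rewrite ler_wiXn2l.
rewrite bc exprMn ler_wpM2l ?exprn_ge0 ?schedule_ge0//.
apply: le_trans c7n; rewrite c7 lerD2l lerN2.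
apply: (@le_trans _ _ (b t ^+ 7 / 2)); last first.
  by rewrite ler_pM2r ?invr_gt0// schedule_exp_le.
rewrite schedule_expr7 mulrAC divff ?pnatr_eq0// mul1r.
have t0 : (0 : R) <= t%:R by rewrite ler0n.
by rewrite lef_pV2 ?posrE; lra.
Qed.

(** Makes [2 eta] a supersolution of the variance recursion: with [p = b t^4] the left side is
    [2 p - 3 p^2 + 2 p^3 <= 2 p (1 - p / 2)]. *)
Lemma schedule_variance_step t :
  (1 - b t ^+ 4) ^+ 2 * (2 * b t ^+ 4) + (b t ^+ 4) ^+ 2 <= 2 * b t.+1 ^+ 4.
Proof.
have b0 := schedule_ge0 t; have := @schedule_step t 4 isT.
have := schedule_exp_le t (isT : (0 <= 4)%N); rewrite expr0.
have : 0 <= b t ^+ 4 by rewrite exprn_ge0.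
move: (b t ^+ 4) (b t.+1 ^+ 4) => p q p0 p1 pq; nra.
Qed.

(** Here [b t^6] is [gamma^2 / eta] up to [gamma0^2]. The left side equals
    [2 b t^2 (1 - b t^4 / 2)], so with the constant 2 the bound of [schedule_step] is exactly
    enough. *)
Lemma schedule_bias_step t :
  (1 - b t ^+ 4) * (2 * b t ^+ 2) + b t ^+ 6 <= 2 * b t.+1 ^+ 2.
Proof. have := @schedule_step t 2 isT; lra. Qed.

Lemma sum_schedule7_le T : \sum_(s < T) b s ^+ 7 <= 2 * ln (T%:R + 1).
Proof.
elim: T => [|T IH]; first by rewrite big_ord0 add0r ln1 mulr0.
rewrite big_ord_recr /=; apply: le_trans (lerD IH (lexx _)) _.
rewrite schedule_expr7.
have T1 : (0 : R) < T%:R + 1 by rewrite ltr_wpDl.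
have T2 : (0 : R) < T%:R + 2 by rewrite ltr_wpDl.
have -> : T.+1%:R + 1 = T%:R + 2 :> R by rewrite -natr1; ring.
(* [ln (1 + x) <= x] at [x = - 1 / (T + 2)] bounds [1 / (T + 2)] by [ln (T + 2) - ln (T + 1)]. *)
have := @le_ln1Dx R (- (T%:R + 2)^-1).
have -> : 1 - (T%:R + 2)^-1 = (T%:R + 1) / (T%:R + 2) :> R.
  by field; rewrite gt_eqF.
rewrite ln_div ?posrE// ltrN2 invf_lt1// => h.
have {}h : ln (T%:R + 1) - ln (T%:R + 2) <= - (T%:R + 2)^-1 :> R.
  by apply: h; rewrite ltr_wpDl// ltr1n.
by lra.
Qed.

(** Each of the [T] terms is at least the last one, [(2 / (T + 1))^(5/7) >= T^(-5/7)]. *)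
Lemma sum_schedule5_ge T : (0 < T)%N ->
  (T%:R : R) `^ (2 / 7) <= \sum_(s < T) b s ^+ 5.
Proof.
case: T => // T _; have T0 : (0 : R) < T.+1%:R by rewrite ltr0n.
have T2 : (0 : R) < T%:R + 2 by rewrite ltr_wpDl.
apply: (@le_trans _ _ (\sum_(s < T.+1) b T ^+ 5)); last first.
  by apply: ler_sum => s _; rewrite lerXn2r ?nnegrE ?schedule_ge0// schedule_nincr// -ltnS.
rewrite sumr_const card_ord -[leRHS]mulr_natl -powR_schedule.
apply: (@le_trans _ _ (T.+1%:R * (T.+1%:R^-1 `^ (5 / 7)))).
  have TV : (T.+1%:R : R)^-1 `^ (5 / 7) = T.+1%:R `^ (- (5 / 7)).
    by rewrite -powR_inv1 ?ler0n// -powRrM mulN1r.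
  have T1 : T.+1%:R * T.+1%:R `^ (- (5 / 7)) = T.+1%:R `^ (1 + - (5 / 7)) :> R.
    by rewrite powRD ?powRr1 ?ler0n// pnatr_eq0 implybT.
  rewrite TV T1 le_eqVlt; apply/orP; left; apply/eqP; congr (_ `^ _); by field.
rewrite ler_wpM2l ?ler0n// ge0_ler_powR ?nnegrE ?divr_ge0 ?invr_ge0 ?ler0n ?(ltW T2)//.
rewrite ler_pdivlMr// mulrC ler_pdivrMr// -natr1.
have : (0 : R) <= T%:R by rewrite ler0n.
by lra.
Qed.

(* Weighting by the stepsizes turns the contraction with factor [q] into a
   telescoping inequality. *)
Lemma sum_contraction (q : R) (A gam delta : nat -> R) T :
  0 <= q -> (forall t, 0 <= A t) -> (forall t, 0 <= delta t) ->
  (forall t, 0 <= gam t) -> (forall t, gam t.+1 <= gam t) ->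
  (forall t, A t.+1 = q * (A t + delta t)) ->
  (1 - q) * (\sum_(t < T) gam t * A t)
    <= gam 0%N * A 0%N + q * \sum_(t < T) gam t * delta t.
Proof.
move=> q0 A0 d0 g0 gS AS.
(* The extra term is what the induction passes on: it pays for the next summand. *)
suff : (1 - q) * (\sum_(t < T) gam t * A t) + gam T * A T
    <= gam 0%N * A 0%N + q * \sum_(t < T) gam t * delta t.
  by apply: le_trans; rewrite lerDl mulr_ge0.
elim: T => [|T IH]; first by rewrite !big_ord0 !mulr0 add0r addr0.
rewrite !big_ord_recr /=.
have : gam T.+1 * A T.+1 <= gam T * A T.+1 by rewrite ler_wpM2r.
rewrite {2}AS; move: (\sum_(_ < _) _) (\sum_(_ < _) _) IH => x y.
lra.
Qed.

End schedule.

(** * Measurability and independence *)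

Section measurable_rV_theory.
Context {R : realType} {d : nat} {dT : measure_display} {T : measurableType dT}.
Implicit Types (f g : T -> 'rV[R]_d).

Lemma measurable_coord (j : 'I_d) :
  measurable_fun setT (fun v : 'rV[R]_d => v ord0 j).
Proof.
move=> _ Y mY; rewrite setTI; apply: sub_sigma_algebra => /=.
rewrite -bigcup_seq/=; exists j => /=; first by rewrite mem_index_enum.
by exists Y => //; rewrite setTI.
Qed.

Lemma measurable_fun_rVP f :
  measurable_fun setT f <-> forall j, measurable_fun setT (fun w => f w ord0 j).
Proof.
split=> [mf j|mf]; first exact: (measurableT_comp (measurable_coord j) mf).
apply: (@measurability _ _ _ _ _ _
  (\big[setU/set0]_(i < d) preimage_set_system setT
     (fun v : 'rV[R]_d => v ord0 i) measurable)) => //.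
move=> _ [B + <-]; rewrite -bigcup_seq => -[j /= _ [C mC <-]].
by rewrite !setTI; have := mf j measurableT C mC; rewrite setTI.
Qed.

Lemma measurable_rVD f g : measurable_fun setT f -> measurable_fun setT g ->
  measurable_fun setT (fun w => f w + g w).
Proof.
move=> /measurable_fun_rVP mf /measurable_fun_rVP mg.
apply/measurable_fun_rVP => j.
rewrite (_ : (fun _ => _) = (fun w => f w ord0 j + g w ord0 j)).
  exact: measurable_funD.
by apply/funext => w; rewrite mxE.
Qed.

Lemma measurable_rVZ (r : T -> R) f : measurable_fun setT r ->
  measurable_fun setT f -> measurable_fun setT (fun w => r w *: f w).
Proof.
move=> mr /measurable_fun_rVP mf; apply/measurable_fun_rVP => j.
rewrite (_ : (fun _ => _) = (fun w => r w * f w ord0 j)).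
  exact: measurable_funM.
by apply/funext => w; rewrite mxE.
Qed.

Lemma measurable_rVB f g : measurable_fun setT f -> measurable_fun setT g ->
  measurable_fun setT (fun w => f w - g w).
Proof.
move=> mf mg; apply: measurable_rVD => //.
rewrite (_ : (fun _ => _) = (fun w => -1 *: g w)).
  by apply: measurable_rVZ.
by apply/funext => w; rewrite scaleN1r.
Qed.

Lemma measurable_rV_sum (I : eqType) (r : seq I) (F : I -> T -> 'rV[R]_d) :
  (forall i, i \in r -> measurable_fun setT (F i)) ->
  measurable_fun setT (fun w => \sum_(i <- r) F i w).
Proof.
elim: r => [_|i r IH mF].
  by under eq_fun do rewrite big_nil; exact: measurable_cst.
under eq_fun do rewrite big_cons; apply: measurable_rVD.
  by apply: mF; rewrite mem_head.
by apply: IH => j jr; apply: mF; rewrite in_cons jr orbT.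
Qed.

Lemma measurable_avg n (F : 'I_n -> T -> 'rV[R]_d) :
  (forall i, measurable_fun setT (F i)) ->
  measurable_fun setT (fun w => avg (F ^~ w)).
Proof.
by move=> mF; apply: measurable_rVZ => //; apply: measurable_rV_sum => i _.
Qed.

Lemma measurable_sqrt : measurable_fun setT (@Num.sqrt R).
Proof. by apply: continuous_measurable_fun; exact: sqrt_continuous. Qed.

Lemma measurable_dotp f g : measurable_fun setT f -> measurable_fun setT g ->
  measurable_fun setT (fun w => dotp (f w) (g w)).
Proof.
move=> /measurable_fun_rVP mf /measurable_fun_rVP mg.
by apply: measurable_sum => j; exact: measurable_funM.
Qed.

Lemma measurable_enorm f : measurable_fun setT f ->
  measurable_fun setT (fun w => enorm (f w)).
Proof.
move=> mf; apply: (measurableT_comp measurable_sqrt).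
rewrite (_ : (fun _ => _) = (fun w => dotp (f w) (f w))) //.
exact: measurable_dotp.
Qed.

(** Inversion is continuous only away from 0, so the line is split into [[set 0]] and its open
    complement. The value at 0 matters because [normalize] may divide by a vanishing norm. *)
Lemma measurable_inv : measurable_fun setT (@GRing.inv R).
Proof.
rewrite -(setUv [set 0 : R]); apply/measurable_funU => //; first exact: measurableC.
split.
- exact: measurable_fun_set1.
- apply: open_continuous_measurable_fun.
    by apply: closed_openC; exact: (accessible_closed_set1 (hausdorff_accessible (@Rhausdorff R))).
  by move=> x; rewrite inE => /eqP x0; exact: inv_continuous.
Qed.

Lemma measurable_normalize f : measurable_fun setT f ->
  measurable_fun setT (fun w => normalize (f w)).
Proof.
move=> mf; apply: measurable_rVZ => //.
by apply: (measurableT_comp measurable_inv); exact: measurable_enorm.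
Qed.

End measurable_rV_theory.

(** * Integrating out an independent variable *)

Section freezing.
Context {dO d1 d2 : measure_display} {Om : measurableType dO}
  {T1 : measurableType d1} {T2 : measurableType d2} {R : realType}.
Context (P : probability Om R) (X : Om -> T1) (W : Om -> T2).
Hypotheses (mX : measurable_fun setT X) (mW : measurable_fun setT W).
Hypothesis indep : forall A B, measurable A -> measurable B ->
  (P (X @^-1` A `&` W @^-1` B) = P (X @^-1` A) * P (W @^-1` B))%E.

(** Independence makes the law of [(X, W)] a product measure, and Tonelli then integrates over [X]
    with [W] frozen. This takes the place of conditioning on the past. *)
Lemma integral_freeze (h : T1 * T2 -> \bar R) :
  measurable_fun setT h -> (forall z, 0 <= h z)%E ->
  (\int[P]_w h (X w, W w) = \int[P]_w \int[P]_w' h (X w', W w))%E.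
Proof.
move=> mh h0.
pose Xm : {mfun Om >-> T1} := HB.pack X (isMeasurableFun.Build _ _ _ _ _ mX).
pose Wm : {mfun Om >-> T2} := HB.pack W (isMeasurableFun.Build _ _ _ _ _ mW).
have mXW : measurable_fun setT (fun w => (X w, W w)) by exact: measurable_fun_pair.
pose XW : {mfun Om >-> (T1 * T2)%type} := HB.pack (fun w => (X w, W w))
  (isMeasurableFun.Build _ _ _ _ _ mXW).
have XWE A B : measurable A -> measurable B ->
    distribution P XW (A `*` B) = (distribution P Xm A * distribution P Wm B)%E.
  by move=> mA mB; rewrite -indep.
transitivity (\int[distribution P XW]_z h z)%E.
  by rewrite ge0_integral_distribution.
transitivity (\int[distribution P Xm \x distribution P Wm]_z h z)%E.
  apply: eq_measure_integral => A mA _; apply/esym.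
  exact: (product_measure_unique XWE).
rewrite fubini_tonelli1// fubini_tonelli//.
rewrite ge0_integral_distribution//; first last.
- by move=> y; exact: integral_ge0.
- exact: measurable_fun_fubini_tonelli_G.
apply: eq_integral => w _ /=; rewrite ge0_integral_distribution//.
exact: measurableT_comp.
Qed.

End freezing.

(** * Bounds on means of nonnegative variables *)

Section mean_le.
Context {dO : measure_display} {Om : measurableType dO} {R : realType}.
Context (P : probability Om R).
Implicit Types (X Y : Om -> R) (a c : R).

(* The integral of a nonnegative function always exists in [\bar R], so bounds of
   this form can be combined before any integrability is known. *)
Definition mean_le X c : Prop :=
  [/\ measurable_fun setT X, forall w, 0 <= X w & (\int[P]_w (X w)%:E <= c%:E)%E].

Lemma mean_leW X c c' : c <= c' -> mean_le X c -> mean_le X c'.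
Proof.
by move=> cc' [mX X0 EX]; split => //; rewrite (le_trans EX)// lee_fin.
Qed.

Lemma mean_le_mono X Y c : measurable_fun setT X -> (forall w, 0 <= X w <= Y w) ->
  mean_le Y c -> mean_le X c.
Proof.
move=> mX XY [mY Y0 EY]; split => // [w|]; first by case/andP: (XY w).
apply: le_trans EY; apply: ge0_le_integral => //.
- by move=> w _; rewrite lee_fin; case/andP: (XY w).
- exact/measurable_EFinP.
- exact/measurable_EFinP.
- by move=> w _; rewrite lee_fin; case/andP: (XY w).
Qed.

Lemma mean_leD X Y c c' : mean_le X c -> mean_le Y c' ->
  mean_le (fun w => X w + Y w) (c + c').
Proof.
move=> [mX X0 EX] [mY Y0 EY]; split => [|w|].
- exact: measurable_funD.
- by rewrite addr_ge0.
- under eq_integral do rewrite EFinD.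
  rewrite ge0_integralD//; first by rewrite EFinD leeD.
  + by move=> w _; rewrite lee_fin.
  + exact/measurable_EFinP.
  + by move=> w _; rewrite lee_fin.
  + exact/measurable_EFinP.
Qed.

Lemma mean_leZ a X c : 0 <= a -> mean_le X c -> mean_le (fun w => a * X w) (a * c).
Proof.
move=> a0 [mX X0 EX]; split => [|w|].
- exact: measurable_funM.
- by rewrite mulr_ge0.
- under eq_integral do rewrite EFinM.
  rewrite ge0_integralZl_EFin//; first by rewrite EFinM lee_wpmul2l.
  + by move=> w _; rewrite lee_fin.
  + exact/measurable_EFinP.
Qed.

Lemma mean_le_cst c : 0 <= c -> mean_le (cst c) c.
Proof.
move=> c0; split => //.
rewrite [X in (X <= _)%E](_ : _ = \int[P]_w cst c%:E w)%E//.
by rewrite integral_cst//= probability_setT mule1.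
Qed.

Lemma mean_le_sum (I : Type) (r : seq I) (X : I -> Om -> R) (c : I -> R) :
  (forall i, mean_le (X i) (c i)) ->
  mean_le (fun w => \sum_(i <- r) X i w) (\sum_(i <- r) c i).
Proof.
move=> EX; elim: r => [|i r IH].
  by under eq_fun do rewrite big_nil; rewrite big_nil; exact: mean_le_cst.
by under eq_fun do rewrite big_cons; rewrite big_cons; exact: mean_leD.
Qed.

(** Jensen's inequality for the square, via AM-GM with weight [l = c + e]: the optimal weight is
    [c], and the slack [e] keeps [l] positive when [c = 0]. *)
Lemma mean_le_sqr X c : measurable_fun setT X -> (forall w, 0 <= X w) -> 0 <= c ->
  mean_le (fun w => X w ^+ 2) (c ^+ 2) -> mean_le X c.
Proof.
move=> mX X0 c0 EX2; split => //; apply/lee_addgt0Pr => e e0.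
pose l := c + e; have l0 : 0 < l by rewrite /l; lra.
have k0 : 0 <= (2 * l)^-1 by rewrite invr_ge0; lra.
have l20 : 0 <= l / 2 by lra.
have := mean_leD (mean_leZ k0 EX2) (mean_le_cst l20).
have bnd : (2 * l)^-1 * c ^+ 2 + l / 2 <= c + e.
  rewrite mulrC -lerBrDr ler_pdivrMr ?mulr_gt0//.
  by rewrite -/l (_ : (l - l / 2) * (2 * l) = l ^+ 2);
    [rewrite lerXn2r ?nnegrE ?(ltW l0)//; rewrite /l; lra | field].
(* AM-GM: [X <= X^2 / (2 l) + l / 2] *)
have amgm w : 0 <= X w <= (2 * l)^-1 * X w ^+ 2 + l / 2.
  rewrite X0/= -subr_ge0.
  have -> : (2 * l)^-1 * X w ^+ 2 + l / 2 - X w = (2 * l)^-1 * (X w - l) ^+ 2.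
    by field; rewrite gt_eqF.
  by rewrite mulr_ge0// sqr_ge0.
by move=> /(mean_leW bnd)/(mean_le_mono mX amgm)[].
Qed.

(** A form of the tower property: the bound [k] on the mean over [X] at each frozen value of [W] is
    integrated over [W]. *)
Lemma mean_le_freeze d1 d2 (T1 : measurableType d1) (T2 : measurableType d2)
    (X : Om -> T1) (W : Om -> T2) (h : T1 * T2 -> R) (k : T2 -> R) c :
  measurable_fun setT X -> measurable_fun setT W ->
  (forall A B, measurable A -> measurable B ->
    (P (X @^-1` A `&` W @^-1` B) = P (X @^-1` A) * P (W @^-1` B))%E) ->
  measurable_fun setT h -> (forall z, 0 <= h z) ->
  (forall y, \int[P]_w (h (X w, y))%:E <= (k y)%:E)%E ->
  mean_le (k \o W) c -> mean_le (fun w => h (X w, W w)) c.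
Proof.
move=> mX mW indep mh h0 hk [mk k0 Ek]; split => //.
  by apply: measurableT_comp => //; exact: measurable_fun_pair.
have mhE : measurable_fun setT (EFin \o h) by exact/measurable_EFinP.
rewrite (integral_freeze mX mW indep mhE); last by move=> z; rewrite lee_fin.
apply: le_trans Ek; apply: ge0_le_integral => //.
- by move=> w _; apply: integral_ge0 => w' _; rewrite lee_fin.
- have mhX : measurable_fun setT (fun z : Om * T2 => (h (X z.1, z.2))%:E).
    apply/measurable_EFinP; apply: measurableT_comp => //.
    apply: measurable_fun_pair => //.
    by apply: (measurableT_comp mX); exact: measurable_fst.
  apply: (measurableT_comp (f := fun y => \int[P]_w (h (X w, y))%:E)%E) => //.
  apply: (measurable_fun_fubini_tonelli_G _ mhX) => z.
  by rewrite lee_fin.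
- exact/measurable_EFinP.
- by move=> w _; exact: hk.
Qed.

(** The events independent of a fixed [B] form a Dynkin system, so independence passes from the
    pi-system [F] to the sigma-algebra it generates. *)
Lemma independent2_sigma (F G : set (set Om)) :
  setI_closed F -> F `<=` measurable -> G `<=` measurable ->
  independent2 P F G -> independent2 P <<s F>> G.
Proof.
move=> FI Fm Gm FG A B FA GB; have mB := Gm _ GB.
pose H := [set A : set Om | measurable A /\ (P (A `&` B) = P A * P B)%E].
suff : <<s F>> `<=` H by move=> /(_ A FA)[].
apply: lambda_system_subset => //; last by move=> X FX; split; [exact: Fm|exact: FG].
apply/dynkin_lambda_system; split.
- by split => //; rewrite setTI probability_setT mul1e.
- move=> X [mX PX]; split; first exact: measurableC.
  rewrite setIC -setDE measureD//; last by rewrite ltey_eq fin_num_measure.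
  rewrite probability_setC// muleBl ?fin_num_measure//.
    by rewrite mul1e (setIC B); congr (_ - _)%E; exact: PX.
- move=> X tX HX; have mX k : measurable (X k) by have [] := HX k.
  split; first exact: bigcupT_measurable.
  rewrite setI_bigcupl !measure_semi_bigcup//; first last.
  + by apply: bigcupT_measurable => k; exact: measurableI.
  + exact: trivIset_setIr.
  + by move=> k; exact: measurableI.
  + exact: bigcupT_measurable.
  rewrite muleC -(fineK (fin_num_measure P _ mB)) -nneseriesZl; last by [].
  apply: eq_eseriesr => k _; rewrite fineK ?fin_num_measure// muleC.
  by have [] := HX k.
Qed.

End mean_le.

(** * Measurability of gradients and of expected values *)

Section measurable_gradient.
Context {R : realType} {d : nat} {dZ : measure_display} {Z : measurableType dZ}.
Context (F : 'rV[R]_d -> Z -> R).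
Hypothesis mF : measurable_fun setT (fun p : 'rV[R]_d * Z => F p.1 p.2).

(** A partial derivative is the limit of difference quotients along the steps [1 / (n + 1)], each
    jointly measurable in the point and the sample. *)
Lemma measurable_grad : (forall z x, differentiable (F ^~ z) x) ->
  measurable_fun setT (fun p : 'rV[R]_d * Z => grad (F ^~ p.2) p.1).
Proof.
move=> dF; apply/measurable_fun_rVP => j.
pose dl : 'rV[R]_d := delta_mx ord0 j.
pose h (n : nat) (p : 'rV[R]_d * Z) : R :=
  (harmonic n)^-1 * (F (harmonic n *: dl + p.1) p.2 - F p.1 p.2).
apply: (@measurable_fun_cvg _ _ _ _ h).
  move=> n; apply: measurable_funM => //; apply: measurable_funB => //.
  apply: (measurableT_comp (f := fun p : 'rV[R]_d * Z => F p.1 p.2)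
    (g := fun p : 'rV[R]_d * Z => (harmonic n *: dl + p.1, p.2))) => //.
  apply: measurable_fun_pair => //; apply: measurable_rVD => //.
move=> [x z] _; rewrite mxE /=.
have /cvgr_dnbhsP := @diff_derivable _ _ _ _ _ dl (dF z x).
apply; split; last exact: cvg_harmonic.
by move=> n; rewrite gt_eqF ?harmonic_gt0.
Qed.

(** Applying Tonelli to the positive and negative parts separately avoids any integrability on the
    product space. *)
Lemma measurable_expected (D : probability Z R) (f : 'rV[R]_d -> R) :
  (forall x, 'E_D[F x] = (f x)%:E)%E -> measurable_fun setT f.
Proof.
move=> hf; apply/measurable_EFinP.
have mFE : measurable_fun setT (fun p : 'rV[R]_d * Z => (F p.1 p.2)%:E).
  exact/measurable_EFinP.
rewrite (_ : EFin \o f = fun x => (\int[D]_z ((fun p => (F p.1 p.2)%:E)^\+ (x, z))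
   - \int[D]_z ((fun p => (F p.1 p.2)%:E)^\- (x, z)))%E); last first.
  apply/funext => x; have := hf x; rewrite unlock /comp => <-; rewrite integralE.
  by congr (_ - _)%E; apply: eq_integral => z _; rewrite ?funeposE ?funenegE.
apply: emeasurable_funB.
  apply: (measurable_fun_fubini_tonelli_F _ (measurable_funepos mFE)) => p.
  exact: funepos_ge0.
apply: (measurable_fun_fubini_tonelli_F _ (measurable_funeneg mFE)) => p.
exact: funeneg_ge0.
Qed.

End measurable_gradient.

(** * Second moment of centered noise *)

Section second_moment.
Context {R : realType} {d : nat} {dZ : measure_display} {Z : measurableType dZ}.
Context (D : probability Z R) (G : Z -> 'rV[R]_d) (m : 'rV[R]_d) (s2 : R).
Hypothesis mG : measurable_fun setT G.
Hypothesis meanG : has_mean D G m.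
Hypothesis varG : ('E_D[fun z => (enorm (G z - m) ^+ 2)%R] <= s2%:E)%E.

(** Centered noise is orthogonal to the constant [w], so the cross terms integrate to zero. After
    freezing, [w] stands for everything known before the sample is drawn. *)
Lemma second_moment_shift (w : 'rV[R]_d) (c : R) :
  (\int[D]_z (enorm (w + c *: (G z - m)) ^+ 2)%:E
    <= (enorm w ^+ 2 + c ^+ 2 * s2)%:E)%E.
Proof.
pose S z := G z - m; have mS : measurable_fun setT S by exact: measurable_rVB.
have mN : measurable_fun setT (fun z => enorm (S z) ^+ 2).
  by apply: measurable_funX; exact: measurable_enorm.
have varS : (\int[D]_z (enorm (S z) ^+ 2)%:E <= s2%:E)%E by have := varG; rewrite unlock.
have iN : D.-integrable setT (fun z => (enorm (S z) ^+ 2)%:E).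
  apply/integrableP; split; first exact/measurable_EFinP.
  rewrite (le_lt_trans _ (ltry s2))//; apply: le_trans varS.
  by rewrite le_eqVlt; apply/orP; left; apply/eqP; apply: eq_integral => z _;
    rewrite gee0_abs// lee_fin sqr_ge0.
have mSj j : measurable_fun setT (fun z => S z ord0 j).
  exact: (measurable_fun_rVP S).1.
have i1 k : D.-integrable setT (EFin \o cst k) by exact: finite_measure_integrable_cst.
(* The coordinates of [S] are integrable because [|s| <= 1 + s^2]; this licenses integrating the
   cross terms separately. *)
have iS j : D.-integrable setT (fun z => (S z ord0 j)%:E).
  apply: (le_integrable _ (g := fun z => (1%:E + (enorm (S z) ^+ 2)%:E)%E)) => //.
  - exact/measurable_EFinP.
  - move=> z _; rewrite /= lee_fin [leRHS]ger0_norm ?addr_ge0 ?sqr_ge0//.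
    have := enorm_entry_le (S z) j; have := sqr_ge0 (enorm (S z) - 1).
    have := sqr_ge0 (enorm (S z)); nra.
  - exact: (integrableD _ (i1 1) iN).
have eS j : (\int[D]_z (S z ord0 j)%:E = 0)%E.
  have := meanG ord0 j; rewrite unlock.
  have GS z : (G z ord0 j)%:E = ((S z ord0 j)%:E + (m ord0 j)%:E)%E.
    by rewrite !mxE -EFinD subrK.
  rewrite (eq_integral _ _ (fun z _ => GS z)).
  rewrite integralD//; last exact: i1.
  rewrite [X in (_ + X)%E](_ : _ = (m ord0 j)%:E); last first.
    by rewrite (integral_cst D measurableT (m ord0 j)%:E)/= probability_setT mule1.
  case: (\int[D]_z _)%E => [r||]//= [rm]; congr EFin.
  by apply: (addIr (m ord0 j)); rewrite add0r.
have eqn z : (enorm (w + c *: S z) ^+ 2)%:E = ((enorm w ^+ 2)%:E +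
    (\sum_j (2 * c * w ord0 j)%:E * (S z ord0 j)%:E +
     (c ^+ 2)%:E * (enorm (S z) ^+ 2)%:E))%E.
  rewrite enorm_sqrD dotpZr enormZ exprMn real_normK ?num_real//.
  rewrite -addrA !EFinD !EFinM; congr (_ + (_ + _))%E.
  rewrite -!EFinM sumEFin; congr EFin.
  by rewrite mulrA /dotp mulr_sumr; apply: eq_bigr => j _; rewrite mulrA.
rewrite (eq_integral _ _ (fun z _ => eqn z)).
have iSw j : D.-integrable setT (fun z => ((2 * c * w ord0 j)%:E * (S z ord0 j)%:E)%E).
  exact: integrableZl.
have iNc : D.-integrable setT (fun z => ((c ^+ 2)%:E * (enorm (S z) ^+ 2)%:E)%E).
  exact: integrableZl.
have isum : D.-integrable setT (fun z =>
    (\sum_j (2 * c * w ord0 j)%:E * (S z ord0 j)%:E)%E) by exact: integrable_sum.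
rewrite integralD//; [|exact: i1|exact: integrableD].
rewrite integralD// integral_sum// big1 => [|j _]; last first.
  by rewrite integralZl// eS mule0.
rewrite (integral_cst D measurableT (enorm w ^+ 2)%:E)/= probability_setT mule1 add0e.
by rewrite integralZl// EFinD leeD2l// (EFinM (c ^+ 2)) lee_wpmul2l ?lee_fin ?sqr_ge0.
Qed.

End second_moment.

(** * Sub-sigma-algebras and adapted maps *)

Section sub_sigma_algebras.
Context {dO : measure_display} {Om : measurableType dO}.
Implicit Types G : set (set Om).

Lemma g_sigma_measurable G : G `<=` measurable -> <<s G>> `<=` measurable.
Proof. by move=> Gm; exact: smallest_sub (@sigma_algebra_measurable _ Om) Gm. Qed.

Lemma sigma_algebra_setI G : sigma_algebra setT G -> setI_closed G.
Proof.
move=> sG A B; rewrite -{1 2 3}(measurable_g_measurableTypeE sG).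
exact: measurableI.
Qed.

Context {dT : measure_display} {T : measurableType dT}.

Lemma sigma_algebra_sigma_of (X : Om -> T) : sigma_algebra setT (sigma_of X).
Proof. exact/sigma_algebra_preimage/sigma_algebra_measurable. Qed.

Lemma sigma_of_preimage (X : Om -> T) A : measurable A -> sigma_of X (X @^-1` A).
Proof. by move=> mA; exists A => //; rewrite setTI. Qed.

Lemma sigma_of_measurable (X : Om -> T) :
  measurable_fun setT X -> sigma_of X `<=` measurable.
Proof. by move=> mX _ [A mA <-]; exact: mX. Qed.

(** Adaptedness is expressed as measurability out of [g_sigma_algebraType G], so all closure lemmas
    for measurable maps apply to adapted ones. *)
Lemma measurable_fun_g_sigma G (X : Om -> T) : sigma_of X `<=` <<s G>> ->
  measurable_fun (setT : set (g_sigma_algebraType G)) X.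
Proof. by move=> XG _ A mA; rewrite setTI; apply: XG; exact: sigma_of_preimage. Qed.

Lemma measurable_fun_sub_sigma G G' (X : Om -> T) : G `<=` <<s G'>> ->
  measurable_fun (setT : set (g_sigma_algebraType G)) X ->
  measurable_fun (setT : set (g_sigma_algebraType G')) X.
Proof.
move=> GG' mX _ A mA.
exact: (smallest_sub (@smallest_sigma_algebra _ setT G') GG') _ (mX measurableT A mA).
Qed.

Lemma measurable_fun_of_sigma G (X : Om -> T) : G `<=` measurable ->
  measurable_fun (setT : set (g_sigma_algebraType G)) X -> measurable_fun setT X.
Proof.
by move=> Gm mX _ A mA; exact: g_sigma_measurable Gm _ (mX measurableT A mA).
Qed.

End sub_sigma_algebras.

(** * Independence of one sigma-algebra from all the others *)

Section independence.
Context {dO : measure_display} {Om : measurableType dO} {R : realType}.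
Context (P : probability Om R).

(** Intersections of one event from each remaining member form a pi-system that generates the
    sigma-algebra of the others. *)
Lemma mutually_independent_others (I : finType) (F : I -> set (set Om)) (k : I) :
  (forall i, sigma_algebra setT (F i)) -> (forall i, F i `<=` measurable) ->
  mutually_independent P F ->
  independent2 P (F k) <<s \bigcup_(i in [set i | i != k]) F i >>.
Proof.
move=> sF mF indF.
have FT i : F i setT by rewrite -(setD0 setT); case: (sF i) => F0 FD _; exact: FD.
pose inter (A : I -> set Om) := \bigcap_(i in [set i | i != k]) A i.
pose Pi := [set inter A | A in [set A | forall i, F i (A i)]].
have PiI : setI_closed Pi.
  move=> _ _ [A FA <-] [B FB <-]; exists (fun i => A i `&` B i).
    by move=> i; exact: sigma_algebra_setI.
  apply/seteqP; split=> w.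
    by move=> h; split=> i ik; have [] := h i ik.
  by move=> [hA hB] i ik; split; [exact: hA|exact: hB].
have mPi : Pi `<=` measurable.
  move=> _ [A FA <-]; apply: fin_bigcap_measurable => [|i _]; last exact/mF.
  exact: finite_finset.
have indPi : independent2 P Pi (F k).
  (* [A'] puts [B] in position [k]. Mutual independence over all indices and over all but [k] gives
     two product formulas, and comparing them yields the claim. *)
  move=> _ B [A FA <-] FB; pose A' i := if i == k then B else A i.
  have FA' i : F i (A' i) by rewrite /A'; case: eqP => [->|].
  have := indF [set: I]%SET A' (fun i _ => FA' i).
  have := indF [set~ k]%SET A' (fun i _ => FA' i).
  have -> : \bigcap_(i in [set` [set~ k]%SET]) A' i = inter A.
    apply: eq_bigcap => [|i]; first by split=> i; rewrite /= !inE.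
    by rewrite /= !inE /A' => /negbTE ->.
  have -> : \bigcap_(i in [set` [set: I]%SET]) A' i = inter A `&` B.
    apply/seteqP; split=> w.
      move=> h; split; last by have := h k; rewrite /A' /= inE eqxx; apply.
      by move=> i /negbTE ik; have := h i; rewrite /A' /= inE ik; apply.
    move=> [h hB] i _; rewrite /A'; case: eqVneq => // ik; exact: h.
  move=> -> ->; rewrite (bigD1 k)//= {1}/A' eqxx muleC; congr (_ * _)%E.
  by apply: eq_bigl => i; rewrite !inE.
have FPi : \bigcup_(i in [set i | i != k]) F i `<=` Pi.
  move=> B [i /= ik FB]; exists (fun j => if j == i then B else setT).
    by move=> j; case: eqP => [->|].
  apply/seteqP; split=> w; first by move=> /(_ i ik); rewrite eqxx.
  by move=> Bw j _; case: eqP.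
move=> A B FA FB; rewrite setIC muleC.
apply: (independent2_sigma PiI mPi (mF k) indPi) => //.
exact: sub_sigma_algebra2 FPi _ FB.
Qed.

Lemma independent2_preimage d1 d2 (T1 : measurableType d1) (T2 : measurableType d2)
    (X : Om -> T1) (W : Om -> T2) (G : set (set Om)) :
  independent2 P (sigma_of X) <<s G>> ->
  measurable_fun (setT : set (g_sigma_algebraType G)) W ->
  forall A B, measurable A -> measurable B ->
    (P (X @^-1` A `&` W @^-1` B) = P (X @^-1` A) * P (W @^-1` B))%E.
Proof.
move=> ind mW A B mA mB; apply: ind; first exact: sigma_of_preimage.
by have := mW measurableT B mB; rewrite setTI.
Qed.

End independence.

(** * Orthogonality of the noise of different clients *)

Section independent_noise.
Context {dO dX dY : measure_display} {Om : measurableType dO} {R : realType}.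
Context {d n : nat} (P : probability Om R).
Context (Xi : 'I_n -> measurableType dX) (X : forall i, Om -> Xi i).
Context (TY : measurableType dY) (H : set (set Om)).
Hypothesis mX : forall i, measurable_fun setT (X i).
Hypothesis mH : H `<=` measurable.
Hypothesis indep : mutually_independent P
  (fun o : option 'I_n => if o is Some i then sigma_of (X i) else <<s H>>).
Context (S : forall i, TY -> Xi i -> 'rV[R]_d) (s2 : R) (s20 : 0 <= s2).
Hypothesis mS : forall i,
  measurable_fun setT (fun p : TY * Xi i => @S i p.1 p.2).
Hypothesis S2 : forall i y (u : 'rV[R]_d) c,
  (\int[P]_w (enorm (u + c *: @S i y (X i w)) ^+ 2)%:E
    <= (enorm u ^+ 2 + c ^+ 2 * s2)%:E)%E.

(** Clients are added one at a time. The partial sum over the earlier ones and the point [Y] depend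
    only on the history and on samples other than [X k], so they can be frozen while [X k] is
    integrated out, which adds [c^2 s2]. *)
Lemma mean_le_noise (W : Om -> 'rV[R]_d) (Y : Om -> TY) c v (r : seq 'I_n) :
  measurable_fun (setT : set (g_sigma_algebraType H)) W ->
  measurable_fun (setT : set (g_sigma_algebraType H)) Y ->
  mean_le P (fun w => enorm (W w) ^+ 2) v -> uniq r ->
  mean_le P (fun w => enorm (W w + c *: \sum_(i <- r) @S i (Y w) (X i w)) ^+ 2)
    (v + (size r)%:R * (c ^+ 2 * s2)).
Proof.
move=> mW mY EW.
pose F (o : option 'I_n) := if o is Some i then sigma_of (X i) else <<s H>>.
have indF : mutually_independent P F := indep.
have sF o : sigma_algebra setT (F o).
  by case: o => [i|]; [exact: sigma_algebra_sigma_of|exact: smallest_sigma_algebra].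
have mF o : F o `<=` measurable.
  by case: o => [i|]; [exact: sigma_of_measurable|exact: g_sigma_measurable].
elim: r => [_|k r IH /= /andP[kr ur]].
  rewrite mul0r addr0; apply: mean_le_mono EW.
    under eq_fun do rewrite big_nil scaler0 addr0.
    apply: measurable_funX; apply: measurable_enorm.
    exact: measurable_fun_of_sigma mW.
  by move=> w; rewrite big_nil scaler0 addr0 sqr_ge0 lexx.
pose G := \bigcup_(o in [set o | o != Some k]) F o.
have mG : G `<=` measurable by apply: bigcup_sub => o _; exact: mF.
have HG : H `<=` <<s G>>.
  move=> A HA; apply: sub_sigma_algebra; exists None => //.
  exact: sub_sigma_algebra.
pose W' w := W w + c *: \sum_(i <- r) @S i (Y w) (X i w).
have mW' : measurable_fun (setT : set (g_sigma_algebraType G)) W'.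
  apply: measurable_rVD; first exact: measurable_fun_sub_sigma mW.
  apply: measurable_rVZ => //.
  apply: measurable_rV_sum => i ir.
  have ik : Some i != Some k by apply: contraNneq kr => -[<-].
  have mp : measurable_fun (setT : set (g_sigma_algebraType G)) (fun w => (Y w, X i w)).
    apply: measurable_fun_pair; first exact: measurable_fun_sub_sigma mY.
    apply: measurable_fun_g_sigma => A XA; apply: sub_sigma_algebra.
    by exists (Some i).
  exact: (measurableT_comp (@mS i) mp).
have mWY : measurable_fun (setT : set (g_sigma_algebraType G)) (fun w => (W' w, Y w)).
  by apply: measurable_fun_pair => //; exact: measurable_fun_sub_sigma mY.
pose h (z : Xi k * ('rV[R]_d * TY)) := enorm (z.2.1 + c *: @S k z.2.2 z.1) ^+ 2.
have mh : measurable_fun setT h.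
  apply: measurable_funX; apply: measurable_enorm; apply: measurable_rVD.
    exact: measurableT_comp.
  apply: measurable_rVZ => //.
  apply: (measurableT_comp (f := fun p : TY * Xi k => @S k p.1 p.2)
    (g := fun z : Xi k * ('rV[R]_d * TY) => (z.2.2, z.1)) (@mS k)).
  by apply: measurable_fun_pair => //; exact: measurableT_comp.
pose q (y : 'rV[R]_d * TY) := enorm y.1 ^+ 2 + c ^+ 2 * s2.
have cs2 : 0 <= c ^+ 2 * s2 by rewrite mulr_ge0// sqr_ge0.
have Eq : mean_le P (q \o (fun w => (W' w, Y w)))
    (v + (size r)%:R * (c ^+ 2 * s2) + c ^+ 2 * s2).
  exact: (mean_leD (IH ur) (mean_le_cst P cs2)).
have := mean_le_freeze (@mX k) (measurable_fun_of_sigma mG mWY)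
  (independent2_preimage (mutually_independent_others (k := Some k) sF mF indF) mWY)
  mh (fun z => sqr_ge0 _) (fun y => @S2 k y.2 y.1 c) Eq.
rewrite -natr1 mulrDl mul1r addrA; congr (mean_le P _ _).
apply/funext => w; rewrite /h /= big_cons /W' scalerDr -addrA.
by rewrite [_ *: @S k _ _ + _]addrC.
Qed.

End independent_noise.

(** * The randomly chosen output iterate *)

Section random_index.
Context {dO dT : measure_display} {Om : measurableType dO} {R : realType}.
Context {TX : measurableType dT} (P : probability Om R).
Context (T : nat) (tau : {RV P >-> nat}) (p : nat -> R).
Context (X : nat -> Om -> TX) (h : TX -> R).
Hypothesis mX : forall t, measurable_fun setT (X t).
Hypothesis mh : measurable_fun setT h.
Hypothesis h0 : forall z, 0 <= h z.
Hypothesis p0 : forall t, 0 <= p t.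
Hypothesis p1 : \sum_(t < T) p t = 1.
Hypothesis tau_law : forall t, (t < T)%N -> P (tau @^-1` [set t]) = (p t)%:E.
Hypothesis indep : independent2 P (sigma_of tau)
  <<s [set A | exists2 t, (t < T)%N & sigma_of (X t) A] >>.

Let pick t w : R := (tau w == t)%:R * h (X t w).

Let measurable_tau t : measurable (tau @^-1` [set t]).
Proof.
have mt : measurable_fun setT tau by [].
by have := mt measurableT [set t] Logic.I; rewrite setTI.
Qed.

Let tau_eq t w : (tau w == t) = (w \in tau @^-1` [set t]).
Proof. by apply/eqP/idP; rewrite inE. Qed.

Let measurable_eq_tau t : measurable_fun setT (fun w => (tau w == t)%:R : R).
Proof.
rewrite (_ : (fun _ => _) = \1_(tau @^-1` [set t])); first exact: measurable_indic.
by apply/funext => w; rewrite indicE tau_eq.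
Qed.

Let integral_tau t : (t < T)%N -> (\int[P]_w ((tau w == t)%:R : R)%:E = (p t)%:E)%E.
Proof.
move=> tT; rewrite -tau_law// -[X in P X]setIT -(integral_indic P measurableT)//.
by apply: eq_integral => w _; rewrite indicE tau_eq.
Qed.

(** As [tau] is independent of [X t], the indicator of [tau = t] may be replaced by its mean. *)
Let integral_pick t : (t < T)%N ->
  (\int[P]_w (pick t w)%:E = \int[P]_w (p t * h (X t w))%:E)%E.
Proof.
move=> tT.
pose hk (z : nat * TX) : R := (z.1 == t)%:R * h z.2.
have mhk : measurable_fun setT (fun z => (hk z)%:E).
  apply/measurable_EFinP/measurable_funM; last exact: measurableT_comp.
  exact: (measurableT_comp (f := fun k : nat => (k == t)%:R : R)).
have aX : measurable_fun (setT : set (g_sigma_algebraType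
    [set A | exists2 t, (t < T)%N & sigma_of (X t) A])) (X t).
  by apply: measurable_fun_g_sigma => A sA; apply: sub_sigma_algebra; exists t.
have mtau : measurable_fun setT tau by [].
have := integral_freeze mtau (@mX t) (independent2_preimage indep aX) mhk.
move=> -> => [|z]; last by rewrite lee_fin mulr_ge0 ?ler0n.
apply: eq_integral => w _; rewrite /hk /=.
under eq_integral do rewrite mulrC EFinM.
rewrite ge0_integralZl_EFin//; last exact/measurable_EFinP.
by rewrite (mulrC (p t)) EFinM; congr (_ * _)%E; exact: integral_tau.
Qed.

Lemma mean_le_random_index c :
  mean_le P (fun w => \sum_(t < T) p t * h (X t w)) c ->
  (\int[P]_w (h (X (tau w) w))%:E <= c%:E)%E.
Proof.
move=> [_ _]; apply: le_trans.
have mpick t : measurable_fun setT (fun w => (pick t w)%:E).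
  apply/measurable_EFinP/measurable_funM => //; exact: measurableT_comp.
have -> : (\int[P]_w (\sum_(t < T) p t * h (X t w))%:E =
    \int[P]_w (\sum_(t < T) pick t w)%:E)%E.
  under eq_integral do rewrite -sumEFin.
  under [RHS]eq_integral do rewrite -sumEFin.
  rewrite !ge0_integral_sum//.
  - by apply: eq_bigr => t _; rewrite integral_pick.
  - by move=> t w _; rewrite lee_fin mulr_ge0 ?ler0n.
  - move=> t; apply/measurable_EFinP/measurable_funM => //; exact: measurableT_comp.
  - by move=> t w _; rewrite lee_fin mulr_ge0.
(* The integrands agree where [tau < T], which is only an almost sure event: its probability is 1
   because the weights [p] sum to 1. *)
rewrite le_eqVlt; apply/orP; left; apply/eqP; apply: ge0_ae_eq_integral => //.
- apply/measurable_EFinP.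
  (* Measurability of [h (X (tau w) w)] is checked on the countably many pieces where [tau] is
     constant. *)
  have cover : \bigcup_k (tau @^-1` [set k]) = [set: Om].
    by apply/seteqP; split => // w _; exists (tau w).
  rewrite -cover; apply/measurable_fun_bigcup => // k.
  apply: (eq_measurable_fun (fun w => h (X k w))).
    by move=> w; rewrite inE /= => ->.
  by apply: measurable_funTS; exact: measurableT_comp.
- under eq_fun do rewrite -sumEFin.
  by apply: emeasurable_sum => t.
- by move=> w _; rewrite lee_fin.
- by move=> w _; rewrite lee_fin sumr_ge0// => t _; rewrite mulr_ge0 ?ler0n.
- have pickE w : (tau w < T)%N -> \sum_(t < T) pick t w = h (X (tau w) w).
    move=> wT; rewrite (bigD1 (Ordinal wT))//= /pick eqxx mul1r big1 ?addr0// => t tw.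
    rewrite (_ : (tau w == t) = false) ?mul0r//.
    by apply/negbTE; apply: contraNneq tw => tw; apply/eqP/val_inj.
  pose B := tau @^-1` [set k | (k < T)%N].
  have mB : measurable B.
    have mt : measurable_fun setT tau by [].
    by have := mt measurableT [set k | (k < T)%N] Logic.I; rewrite setTI.
  have PB : (P (~` B) = 0)%E.
    rewrite probability_setC// -[X in P X]setIT -(integral_indic P measurableT)//.
    have -> : (\int[P]_w (\1_B w)%:E = \int[P]_w (\sum_(t < T) (tau w == t)%:R%:E))%E.
      apply: eq_integral => w _; rewrite sumEFin; congr EFin.
      rewrite indicE; case: (ltnP (tau w) T) => wT.
        rewrite mem_set// (bigD1 (Ordinal wT))//= eqxx big1 ?addr0// => t tw.
        rewrite (_ : (tau w == t) = false)//.
        by apply/negbTE; apply: contraNneq tw => tw; apply/eqP/val_inj.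
      rewrite memNset ?big1//= => [t _|]; last by rewrite /B /= ltnNge wT.
      by rewrite gtn_eqF// (leq_trans (ltn_ord t)).
    rewrite ge0_integral_sum//.
    + under eq_bigr do rewrite integral_tau//.
      by rewrite sumEFin p1 subee.
    + by move=> t; exact/measurable_EFinP.
  exists (~` B); split => //; first exact: measurableC.
  move=> w /= wB Bw; apply: wB => _; congr EFin; symmetry; exact: pickE.
Qed.

End random_index.

(** * Analysis of the algorithm *)

Section ef21_igt_analysis.
Context {R : realType} {d n : nat} {dX dZ dO : measure_display}.
Context (Xi : 'I_n -> measurableType dX) (D : forall i, probability (Xi i) R).
Context (Z : 'I_n -> nat -> measurableType dZ).
Context (F : forall i, 'rV[R]_d -> Xi i -> R) (fi : 'I_n -> 'rV[R]_d -> R).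
Context (Cmp : forall i t, Z i t -> 'rV[R]_d -> 'rV[R]_d).
Context {Om : measurableType dO} (P : probability Om R).
Context (xi : forall i, nat -> {RV P >-> Xi i}) (zeta : forall i t, {RV P >-> Z i t}).
Context (alpha L sg gamma0 : R) (Li Lhi : 'I_n -> R) (gamma eta : nat -> R).
Context (x0 : 'rV[R]_d) (g0 v0 : 'I_n -> 'rV[R]_d).

Hypothesis n_gt0 : (0 < n)%N.
Hypothesis measurableF : forall i,
  measurable_fun setT (fun p : 'rV[R]_d * Xi i => @F i p.1 p.2).
Hypothesis meanF : forall i x, ('E_(D i)[@F i x] = (fi i x)%:E)%E.
Hypothesis smoothF : forall i z, twice_differentiable (fun x => @F i x z).
Hypothesis smooth_fi : forall i, twice_differentiable (fi i).
Hypothesis measurableC : forall i t,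
  measurable_fun setT (fun p : Z i t * 'rV[R]_d => @Cmp i t p.1 p.2).
Hypothesis hxi : fresh_samples D xi zeta.
Hypothesis hzeta : fresh_compressors xi zeta.
Hypothesis halpha : 0 < alpha <= 1.
Hypothesis hC : forall i t,
  contractive P alpha (fun w => @Cmp i t.+1 (zeta i t.+1 w)).
Hypothesis Li_ge0 : forall i, 0 <= Li i.
Hypothesis lipschitz_fi : forall i x y,
  enorm (grad (fi i) x - grad (fi i) y) <= Li i * enorm (x - y).
Hypothesis Lhi_ge0 : forall i, 0 <= Lhi i.
Hypothesis lipschitz_hess : forall i x y,
  specnorm (hess (fi i) x - hess (fi i) y) <= Lhi i * enorm (x - y).
Hypothesis sg_ge0 : 0 <= sg.
Hypothesis mean_grad : forall i x,
  has_mean (D i) (fun z => grad (fun x => @F i x z) x) (grad (fi i) x).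
Hypothesis var_grad : forall i x,
  ('E_(D i)[fun z => (enorm (grad (fun x => @F i x z) x - grad (fi i) x) ^+ 2)%R]
     <= (sg ^+ 2)%:E)%E.
Hypothesis gamma0_gt0 : 0 < gamma0.
Hypothesis gammaE : forall t, gamma t = gamma0 * schedule t ^+ 5.
Hypothesis etaE : forall t, eta t = schedule t ^+ 4.

Local Notation b := (@schedule R).

Let noise i (u : 'rV[R]_d) (z : Xi i) := grad (fun x => @F i x z) u - grad (fi i) u.

(* The trajectories are arbitrary functions satisfying the recursion of the
   algorithm rather than [ef21_igt] itself, so that it never gets unfolded.  The
   tracking error [v i - grad (fi i) x] splits into [M i], which collects the
   sampling noise, and a remainder that is bounded deterministically. *)
Context (x y : nat -> Om -> 'rV[R]_d) (g v M : 'I_n -> nat -> Om -> 'rV[R]_d).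
Hypothesis xg0 : forall w, x 0%N w = x0.
Hypothesis gg0 : forall i w, g i 0%N w = g0 i.
Hypothesis vg0 : forall i w, v i 0%N w = v0 i.
Hypothesis M0 : forall i w, M i 0%N w = 0.
Hypothesis xS : forall t w,
  x t.+1 w = x t w - gamma t *: normalize (avg (fun i => g i t w)).
Hypothesis yE : forall t w,
  y t w = x t.+1 w + ((1 - eta t) / eta t) *: (x t.+1 w - x t w).
Hypothesis vS : forall i t w, v i t.+1 w =
  (1 - eta t) *: v i t w + eta t *: grad (fun x => @F i x (xi i t.+1 w)) (y t w).
Hypothesis gS : forall i t w, g i t.+1 w =
  g i t w + @Cmp i t.+1 (zeta i t.+1 w) (v i t.+1 w - g i t w).
Hypothesis MS : forall i t w, M i t.+1 w =
  (1 - eta t) *: M i t w + eta t *: @noise i (y t w) (xi i t.+1 w).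

(** These sets generate [history a c]. The half-round [past t.+1 t] is the moment of compression. *)
Let past (a c : nat) : set (set Om) :=
  [set A | (exists i s, (0 < s <= a)%N /\ sigma_of (xi i s) A) \/
           (exists i s, (0 < s <= c)%N /\ sigma_of (zeta i s) A)].

Let adapted a c (f : Om -> 'rV[R]_d) :=
  measurable_fun (setT : set (g_sigma_algebraType (past a c))) f.

Let past_measurable a c : past a c `<=` measurable.
Proof.
by move=> A [] [i [s [_ +]]]; apply: sigma_of_measurable.
Qed.

Let adapted_mono a c a' c' f : (a <= a')%N -> (c <= c')%N ->
  adapted a c f -> adapted a' c' f.
Proof.
move=> aa cc; apply: measurable_fun_sub_sigma => A.
move=> [] [i [s [/andP[s0 sa] sA]]]; apply: sub_sigma_algebra.
  by left; exists i, s; rewrite s0 (leq_trans sa aa).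
by right; exists i, s; rewrite s0 (leq_trans sa cc).
Qed.

Let measurable_gradF i : measurable_fun setT
  (fun p : 'rV[R]_d * Xi i => grad (fun x => @F i x p.2) p.1).
Proof. by apply: measurable_grad => // z u; have [] := @smoothF i z u. Qed.

Let measurable_grad_fi i : measurable_fun setT (grad (fi i)).
Proof.
have mfi := measurable_expected (@measurableF i) (meanF i).
have := @measurable_grad R d _ (Xi i) (fun u _ => fi i u).
move=> /(_ (measurableT_comp mfi measurable_fst)) mg.
have {}mg := mg (fun _ u => proj1 (@smooth_fi i u)).
exact: (measurableT_comp mg (pair2_measurable (point : Xi i))).
Qed.

Let measurable_noise i : measurable_fun setT
  (fun p : 'rV[R]_d * Xi i => @noise i p.1 p.2).
Proof.
apply: measurable_rVB; first exact: measurable_gradF.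
exact: (measurableT_comp (@measurable_grad_fi i) measurable_fst).
Qed.

Let adapted_sample i t u : adapted t.+1 t u ->
  measurable_fun (setT : set (g_sigma_algebraType (past t.+1 t)))
    (fun w => (u w, xi i t.+1 w)).
Proof.
move=> mu; apply: measurable_fun_pair => //; apply: measurable_fun_g_sigma => A sA.
by apply: sub_sigma_algebra; left; exists i, t.+1; rewrite leqnn.
Qed.

Lemma adapted_state t : [/\ adapted t t (x t), forall i, adapted t t (g i t),
  forall i, adapted t t (v i t) & forall i, adapted t t (M i t)].
Proof.
elim: t => [|t [ax ag av aM]].
  by split=> [|i|i|i]; [rewrite (funext xg0)|rewrite (funext (gg0 i))
    |rewrite (funext (vg0 i))|rewrite (funext (M0 i))]; exact: measurable_cst.
have ax' : adapted t t (x t.+1).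
  rewrite (funext (xS t)); apply: measurable_rVB => //; apply: measurable_rVZ => //.
  by apply: measurable_normalize; exact: measurable_avg.
have ay : adapted t.+1 t (y t).
  apply: (adapted_mono (leqnSn t) (leqnn t)); rewrite (funext (yE t)).
  apply: measurable_rVD => //; apply: measurable_rVZ => //; exact: measurable_rVB.
have up (u : Om -> 'rV[R]_d) : adapted t t u -> adapted t.+1 t u by exact: adapted_mono.
have up' (u : Om -> 'rV[R]_d) : adapted t.+1 t u -> adapted t.+1 t.+1 u by exact: adapted_mono.
have av' i : adapted t.+1 t (v i t.+1).
  rewrite (funext (vS i t)).
  apply: measurable_rVD; first by apply: measurable_rVZ => //; exact: (up _ (av i)).
  apply: measurable_rVZ => //.
  exact: (measurableT_comp (@measurable_gradF i) (@adapted_sample i t _ ay)).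
split=> [|i|i|i]; [exact: (up' _ (up _ ax'))| |exact: (up' _ (av' i))|].
- rewrite (funext (gS i t)); apply: measurable_rVD; first exact: (up' _ (up _ (ag i))).
  have mz : measurable_fun (setT : set (g_sigma_algebraType (past t.+1 t.+1)))
      (fun w => (zeta i t.+1 w, v i t.+1 w - g i t w)).
    apply: measurable_fun_pair.
      apply: measurable_fun_g_sigma => A sA; apply: sub_sigma_algebra.
      by right; exists i, t.+1; rewrite leqnn.
    by apply: measurable_rVB; [exact: (up' _ (av' i))|exact: (up' _ (up _ (ag i)))].
  exact: (measurableT_comp (@measurableC i t.+1) mz).
- rewrite (funext (MS i t)).
  apply: up'; apply: measurable_rVD; first by apply: measurable_rVZ => //; exact: (up _ (aM i)).
  apply: measurable_rVZ => //.
  exact: (measurableT_comp (@measurable_noise i) (@adapted_sample i t _ ay)).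
Qed.

Let adapted_x t : adapted t t (x t). Proof. by case: (adapted_state t). Qed.
Let adapted_g i t : adapted t t (g i t). Proof. by case: (adapted_state t). Qed.
Let adapted_v i t : adapted t t (v i t). Proof. by case: (adapted_state t). Qed.
Let adapted_M i t : adapted t t (M i t). Proof. by case: (adapted_state t). Qed.

(** The point [y t] involves no randomness of round [t.+1], so with [y t] frozen the sampling noise
    there is centered. *)
Let adapted_y t : adapted t t (y t).
Proof.
have ax' : adapted t t (x t.+1).
  rewrite (funext (xS t)); apply: measurable_rVB; first exact: adapted_x.
  apply: measurable_rVZ; first exact: measurable_cst.
  by apply: measurable_normalize; apply: measurable_avg => i; exact: adapted_g.
rewrite (funext (yE t)); apply: measurable_rVD; first exact: ax'.
apply: measurable_rVZ; first exact: measurable_cst.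
by apply: measurable_rVB; [exact: ax'|exact: adapted_x].
Qed.

Let measurable_adapted a c f : adapted a c f -> measurable_fun setT f.
Proof. by apply: measurable_fun_of_sigma; exact: past_measurable. Qed.

(** * Noise part and remainder of the tracking error *)

Let second_moment_sample i t u (a : 'rV[R]_d) c :
  (\int[P]_w (enorm (a + c *: @noise i u (xi i t.+1 w)) ^+ 2)%:E
    <= (enorm a ^+ 2 + c ^+ 2 * sg ^+ 2)%:E)%E.
Proof.
have mG : measurable_fun setT (fun z : Xi i => grad (fun x => @F i x z) u).
  exact: (measurableT_comp (@measurable_gradF i) (pair1_measurable u)).
have := second_moment_shift mG (@mean_grad i u) (@var_grad i u) a c.
have mh : measurable_fun setT (fun z : Xi i => (enorm (a + c *: @noise i u z) ^+ 2)%:E).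
  apply/measurable_EFinP; apply: measurable_funX; apply: measurable_enorm.
  by apply: measurable_rVD => //; apply: measurable_rVZ => //; exact: measurable_rVB.
have <- : (\int[distribution P (xi i t.+1)]_z (enorm (a + c *: @noise i u z) ^+ 2)%:E
    = \int[D i]_z (enorm (a + c *: @noise i u z) ^+ 2)%:E)%E.
  by apply: eq_measure_integral => A mA _; exact: (proj1 hxi).
by rewrite ge0_integral_distribution// => z; rewrite lee_fin sqr_ge0.
Qed.

Let mean_le_round_noise t (W : Om -> 'rV[R]_d) c s (r : seq 'I_n) :
  adapted t t W -> mean_le P (fun w => enorm (W w) ^+ 2) s -> uniq r ->
  mean_le P (fun w =>
      enorm (W w + c *: \sum_(i <- r) @noise i (y t w) (xi i t.+1 w)) ^+ 2)
    (s + (size r)%:R * (c ^+ 2 * sg ^+ 2)).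
Proof.
move=> aW EW ur.
have mX (i : 'I_n) : measurable_fun setT (xi i t.+1) by [].
exact: (mean_le_noise mX (@past_measurable t t) (proj2 hxi t) (sqr_ge0 sg)
  measurable_noise (fun i => @second_moment_sample i t) c aW (@adapted_y t) EW ur).
Qed.

(** The list [r] and weight [k] let one proof serve both a single client ([k = 1]) and the average
    over all clients ([k = 1 / n], where [size r * k^2 = 1 / n]). *)
Lemma noise_average_bound (r : seq 'I_n) (k : R) (N : nat -> Om -> 'rV[R]_d) t :
  uniq r -> (forall w, N 0%N w = 0) -> (forall t, adapted t t (N t)) ->
  (forall t w, N t.+1 w = (1 - eta t) *: N t w
     + (eta t * k) *: \sum_(i <- r) @noise i (y t w) (xi i t.+1 w)) ->
  mean_le P (fun w => enorm (N t w) ^+ 2)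
    (2 * b t ^+ 4 * ((size r)%:R * (k ^+ 2 * sg ^+ 2))).
Proof.
move=> ur N0 aN NS; set K := (size r)%:R * _.
have K0 : 0 <= K.
  by apply: mulr_ge0; [rewrite ler0n|apply: mulr_ge0; rewrite sqr_ge0].
elim: t => [|t IH].
  have z : 0 <= 2 * b 0 ^+ 4 * K by rewrite mulr_ge0// mulr_ge0// exprn_ge0// schedule_ge0.
  apply: mean_le_mono (mean_le_cst P z).
    apply: measurable_funX; apply: measurable_enorm.
    exact: measurable_adapted (aN 0%N).
  by move=> w; rewrite N0 enorm0 expr0n/= lexx.
have aW : adapted t t (fun w => (1 - eta t) *: N t w).
  by apply: measurable_rVZ; [exact: measurable_cst|exact: aN].
have EW : mean_le P (fun w => enorm ((1 - eta t) *: N t w) ^+ 2)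
    ((1 - eta t) ^+ 2 * (2 * b t ^+ 4 * K)).
  have := mean_leZ (sqr_ge0 (1 - eta t)) IH; congr (mean_le P _ _).
  by apply/funext => w; rewrite enormZ exprMn real_normK ?num_real.
have := mean_le_round_noise (eta t * k) aW EW ur.
rewrite -(funext (fun w => congr1 (fun u => enorm u ^+ 2) (NS t w))).
apply: mean_leW; rewrite etaE.
have -> : (1 - b t ^+ 4) ^+ 2 * (2 * b t ^+ 4 * K) +
    (size r)%:R * ((b t ^+ 4 * k) ^+ 2 * sg ^+ 2) =
    ((1 - b t ^+ 4) ^+ 2 * (2 * b t ^+ 4) + (b t ^+ 4) ^+ 2) * K.
  by rewrite /K; ring.
by rewrite ler_wpM2r// schedule_variance_step.
Qed.

Let enorm_le_sqr t k (N : Om -> 'rV[R]_d) : 0 <= k -> measurable_fun setT N ->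
  mean_le P (fun w => enorm (N w) ^+ 2) (2 * b t ^+ 4 * k ^+ 2) ->
  mean_le P (fun w => enorm (N w)) (2 * b t ^+ 2 * k).
Proof.
move=> k0 mN EN; have b2 : 0 <= b t ^+ 2 by rewrite sqr_ge0.
apply: mean_le_sqr.
- exact: measurable_enorm.
- by move=> w; exact: enorm_ge0.
- by rewrite mulr_ge0// mulr_ge0.
- apply: mean_leW EN; rewrite !exprMn.
  have : 0 <= b t ^+ 4 * k ^+ 2 by rewrite mulr_ge0// ?sqr_ge0// exprn_ge0// schedule_ge0.
  lra.
Qed.

Lemma mean_martingale i t : mean_le P (fun w => enorm (M i t w)) (2 * b t ^+ 2 * sg).
Proof.
apply: enorm_le_sqr => //; first exact: measurable_adapted (@adapted_M i t).
have := @noise_average_bound [:: i] 1 (M i) t isT (M0 i) (@adapted_M i).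
rewrite expr1n !mul1r; apply => s w.
by rewrite mulr1 big_seq1 MS.
Qed.

Lemma mean_avg_martingale t :
  mean_le P (fun w => enorm (avg (fun i => M i t w))) (2 * b t ^+ 2 * (sg / Num.sqrt n%:R)).
Proof.
have nR : (n%:R : R) != 0 by rewrite pnatr_eq0 -lt0n.
apply: enorm_le_sqr.
- by rewrite divr_ge0// sqrtr_ge0.
- by apply: measurable_avg => i; exact: measurable_adapted (@adapted_M i t).
have := @noise_average_bound (index_enum 'I_n) n%:R^-1
  (fun t w => avg (fun i => M i t w)) t (index_enum_uniq _).
have -> : (size (index_enum 'I_n))%:R * (n%:R^-1 ^+ 2 * sg ^+ 2) =
    (sg / Num.sqrt n%:R) ^+ 2 :> R.
  have -> : size (index_enum 'I_n) = n by rewrite -sum1_size sum1_card card_ord.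
  rewrite expr_div_n sqr_sqrtr//.
  by field.
apply.
- by move=> w; rewrite /avg big1// scaler0.
- by move=> s; apply: measurable_avg => i; exact: adapted_M.
- move=> s w; rewrite /avg (eq_bigr _ (fun i _ => MS i s w)) big_split/=.
  by rewrite -!scaler_sumr scalerDr !scalerA !(mulrC n%:R^-1).
Qed.

Let eta_itv t : 0 < eta t <= 1.
Proof.
by rewrite etaE exprn_gt0 ?schedule_gt0//= exprn_ile1 ?schedule_ge0 ?schedule_le1.
Qed.

Let gamma_ge0 t : 0 <= gamma t.
Proof. by rewrite gammaE mulr_ge0 ?(ltW gamma0_gt0)// exprn_ge0// schedule_ge0. Qed.

Let step_le t w : enorm (x t.+1 w - x t w) <= gamma t.
Proof.
rewrite xS addrAC subrr add0r enormN enormZ ger0_norm ?gamma_ge0//.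
by rewrite ler_piMr ?gamma_ge0 ?enorm_normalize_le1.
Qed.

(** Indexed from round 1 because the remainder of round 0 is [v0 i - grad (fi i) x0], which is
    arbitrary; the first update erases it. *)
Lemma tracking_remainder i t w :
  enorm (v i t.+1 w - grad (fi i) (x t.+1 w) - M i t.+1 w)
    <= 2 * b t.+1 ^+ 2 * (Lhi i * gamma0 ^+ 2).
Proof.
set K := Lhi i * gamma0 ^+ 2.
have K0 : 0 <= K by rewrite mulr_ge0 ?sqr_ge0.
pose N s := v i s w - grad (fi i) (x s w) - M i s w.
pose rem s := (1 - eta s) *: grad (fi i) (x s w) + eta s *: grad (fi i) (y s w)
  - grad (fi i) (x s.+1 w).
have NS s : N s.+1 = (1 - eta s) *: N s + rem s.
  rewrite /N /rem vS MS /noise.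
  move: (v i s w) (grad _ (y s w)) (grad (fi i) (x s w)) (grad (fi i) (y s w))
    (grad (fi i) (x s.+1 w)) (M i s w) => p q u z k m.
  by apply/rowP => j; rewrite !mxE; ring.
have rem_le s : enorm (rem s) <= b s ^+ 6 * K.
  rewrite /rem yE; apply: le_trans (transport_remainder _ _ (Lhi_ge0 i) (eta_itv s)
    (@smooth_fi i) (@lipschitz_hess i)) _.
  have bs := schedule_gt0 (R := R) s.
  have -> : b s ^+ 6 * K = Lhi i * (gamma s ^+ 2 / eta s).
    by rewrite gammaE etaE /K; field; rewrite gt_eqF.
  rewrite ler_wpM2l// ler_pM2r ?invr_gt0; last by case/andP: (eta_itv s).
  by rewrite lerXn2r ?nnegrE ?enorm_ge0 ?gamma_ge0.
suff : enorm (N t.+1) <= 2 * b t.+1 ^+ 2 * K by [].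
elim: t => [|t IH].
  rewrite NS etaE schedule0 expr1n subrr scale0r add0r (le_trans (rem_le 0%N))//.
  rewrite ler_wpM2r// schedule0 expr1n.
  (* [schedule_step] at 0 gives [1 / 2 <= b 1 ^+ 2]. *)
  by have := @schedule_step R 0 2 isT; rewrite schedule0 !expr1n; lra.
have := eta_itv t.+1 => /andP[_ e1]; rewrite NS.
apply: le_trans (ler_enormD _ _) _; rewrite enormZ ger0_norm ?subr_ge0//.
have h1 : (1 - eta t.+1) * enorm (N t.+1) <= (1 - eta t.+1) * (2 * b t.+1 ^+ 2 * K).
  by rewrite ler_wpM2l// subr_ge0.
apply: le_trans (lerD h1 (rem_le t.+1)) _.
have -> : (1 - eta t.+1) * (2 * b t.+1 ^+ 2 * K) + b t.+1 ^+ 6 * K =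
    ((1 - b t.+1 ^+ 4) * (2 * b t.+1 ^+ 2) + b t.+1 ^+ 6) * K by rewrite etaE; ring.
by rewrite ler_wpM2r// schedule_bias_step.
Qed.

(** * Compression error *)

Let q := Num.sqrt (1 - alpha).

Let q_ge0 : 0 <= q. Proof. exact: sqrtr_ge0. Qed.

Let q_sqr : q ^+ 2 = 1 - alpha.
Proof. by rewrite sqr_sqrtr// subr_ge0; case/andP: halpha. Qed.

(* [drift i t] bounds the mean of [enorm (v i t.+1 - v i t)]. *)
Let drift i t := b t ^+ 2 * (3 * sg + Li i * gamma0 + 2 * (Lhi i * gamma0 ^+ 2))
  + (t == 0)%N%:R * enorm (v0 i - grad (fi i) x0).

(** Solves the error recursion with equality, the form that [sum_contraction] takes. *)
Fixpoint compression_bound i t :=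
  if t is t'.+1 then q * (compression_bound i t' + drift i t')
  else enorm (g0 i - v0 i).

Let mean_noise i t :
  mean_le P (fun w => enorm (@noise i (y t w) (xi i t.+1 w))) sg.
Proof.
have a0 : adapted t t (fun=> 0) by exact: measurable_cst.
have E0 : mean_le P (fun w => enorm (0 : 'rV[R]_d) ^+ 2) 0.
  by rewrite enorm0 expr0n/=; exact: mean_le_cst.
have := @mean_le_round_noise t _ 1 0 [:: i] a0 E0 isT.
rewrite expr1n !mul1r add0r => h; apply: mean_le_sqr => //.
- have au : adapted t.+1 t (y t) by exact: (adapted_mono (leqnSn t) (leqnn t) (@adapted_y t)).
  have := measurableT_comp (@measurable_noise i) (@adapted_sample i t _ au).
  by move=> /measurable_adapted; exact: measurable_enorm.
- by move=> w; exact: enorm_ge0.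
- congr (mean_le P _ _): h; apply/funext => w.
  by rewrite big_seq1 add0r scale1r.
Qed.

(** Round 0 is separate: its tracking error is deterministic and becomes the [v0 i - grad (fi i) x0]
    term of [V_init]. Later rounds use noise plus remainder, with [eta <= 1]. *)
Let mean_tracking i t : mean_le P
  (fun w => eta t * enorm (v i t w - grad (fi i) (x t w)))
  (b t ^+ 2 * (2 * sg + 2 * (Lhi i * gamma0 ^+ 2))
   + (t == 0)%N%:R * enorm (v0 i - grad (fi i) x0)).
Proof.
have K0 : 0 <= Lhi i * gamma0 ^+ 2 by rewrite mulr_ge0 ?sqr_ge0.
have mu : measurable_fun setT (fun w => eta t * enorm (v i t w - grad (fi i) (x t w))).
  apply: measurable_funM => //; apply: measurable_enorm; apply: measurable_rVB.
    exact: measurable_adapted (@adapted_v i t).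
  exact: measurableT_comp (@measurable_grad_fi i) (measurable_adapted (@adapted_x t)).
have := eta_itv t => /andP[e0 e1].
case: t => [|t] in mu e0 e1 *.
  rewrite mul1r; set c := _ + _; have c0 : 0 <= c.
    rewrite addr_ge0 ?enorm_ge0// mulr_ge0 ?sqr_ge0//.
    by have := sg_ge0; lra.
  apply: mean_le_mono mu _ (mean_le_cst P c0) => w.
  rewrite mulr_ge0 ?enorm_ge0 ?(ltW e0)//= vg0 xg0 etaE schedule0 !expr1n !mul1r.
  by rewrite /c schedule0 expr1n mul1r; have := sg_ge0; lra.
rewrite mul0r addr0.
have rem0 : 0 <= 2 * b t.+1 ^+ 2 * (Lhi i * gamma0 ^+ 2).
  by rewrite mulr_ge0// mulr_ge0// sqr_ge0.
have := mean_leD (mean_martingale i t.+1) (mean_le_cst P rem0).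
have -> : 2 * b t.+1 ^+ 2 * sg + 2 * b t.+1 ^+ 2 * (Lhi i * gamma0 ^+ 2) =
    b t.+1 ^+ 2 * (2 * sg + 2 * (Lhi i * gamma0 ^+ 2)) by ring.
apply: mean_le_mono mu _ => w; rewrite mulr_ge0 ?enorm_ge0 ?(ltW e0)//=.
apply: (@le_trans _ _ (enorm (v i t.+1 w - grad (fi i) (x t.+1 w)))).
  by rewrite ler_piMl ?enorm_ge0.
rewrite -[X in enorm X <= _](subrK (M i t.+1 w)) addrC.
apply: le_trans (ler_enormD _ _) _; rewrite lerD2l.
exact: tracking_remainder.
Qed.

(** The increment is [eta] times fresh noise, plus [eta] times the gradient difference between [y]
    and [x], minus [eta] times the tracking error. As [y - x = (x' - x) / eta], the middle term is
    at most [L_i gamma] despite the long extrapolation. Of the [3 sg] in [drift], one comes from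
    fresh noise and two from tracking. *)
Let mean_increment i t : mean_le P (fun w => enorm (v i t.+1 w - v i t w)) (drift i t).
Proof.
have mv s : measurable_fun setT (v i s) by exact: measurable_adapted (@adapted_v i s).
have Lg0 : 0 <= Li i * gamma t by rewrite mulr_ge0.
have := eta_itv t => /andP[e0 e1].
have Esum := mean_leD (mean_leD (mean_leZ (ltW e0) (mean_noise i t))
  (mean_le_cst P Lg0)) (mean_tracking i t).
apply: mean_leW (mean_le_mono _ _ Esum).
- have b0 := schedule_ge0 (R := R) t.
  have b42 := schedule_exp_le (R := R) t (isT : (2 <= 4)%N).
  have b52 := schedule_exp_le (R := R) t (isT : (2 <= 5)%N).
  have h1 : b t ^+ 4 * sg <= b t ^+ 2 * sg by rewrite ler_wpM2r.
  have h2 : Li i * gamma0 * b t ^+ 5 <= Li i * gamma0 * b t ^+ 2.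
    by rewrite ler_wpM2l// mulr_ge0// ltW.
  by rewrite /drift etaE gammaE; lra.
- by apply: measurable_enorm; exact: measurable_rVB.
move=> w; rewrite enorm_ge0/=.
have yx : enorm (eta t *: (grad (fi i) (y t w) - grad (fi i) (x t w))) <= Li i * gamma t.
  rewrite enormZ gtr0_norm//.
  have -> : gamma t = eta t * (gamma t / eta t) by rewrite mulrCA divff ?mulr1// gt_eqF.
  rewrite mulrCA ler_pM2l//; apply: le_trans (@lipschitz_fi i _ _) _.
  rewrite ler_wpM2l//.
  have -> : y t w - x t w = (eta t)^-1 *: (x t.+1 w - x t w).
    rewrite yE; apply/rowP => j; rewrite !mxE; field; rewrite gt_eqF//.
  by rewrite enormZ gtr0_norm ?invr_gt0// mulrC ler_pM2r ?invr_gt0// step_le.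
have -> : v i t.+1 w - v i t w = eta t *: @noise i (y t w) (xi i t.+1 w)
    + eta t *: (grad (fi i) (y t w) - grad (fi i) (x t w))
    - eta t *: (v i t w - grad (fi i) (x t w)).
  rewrite vS /noise.
  move: (v i t w) (grad _ (y t w)) (grad (fi i) (x t w)) (grad (fi i) (y t w)) => p r u z.
  by apply/rowP => j; rewrite !mxE; ring.
apply: le_trans (ler_enormB _ _) _; rewrite [in X in _ + X]enormZ gtr0_norm// lerD2r.
apply: le_trans (ler_enormD _ _) _; rewrite [in X in X + _]enormZ gtr0_norm//.
by rewrite lerD2l.
Qed.

(** With [U = v' - g], the new error [g' - v'] is the compression error [C(U) - U]. [U] is known
    before the seeds of the round are drawn, so it can be frozen. *)
Lemma mean_compression_error i t :
  mean_le P (fun w => enorm (g i t w - v i t w)) (compression_bound i t).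
Proof.
have mv s : measurable_fun setT (v i s) by exact: measurable_adapted (@adapted_v i s).
have mg s : measurable_fun setT (g i s) by exact: measurable_adapted (@adapted_g i s).
elim: t => [|t IH].
  apply: mean_le_mono _ _ (mean_le_cst P (enorm_ge0 (g0 i - v0 i))).
    by apply: measurable_enorm; exact: measurable_rVB.
  by move=> w; rewrite gg0 vg0 enorm_ge0 lexx.
pose U w := v i t.+1 w - g i t w.
have aU : adapted t.+1 t U.
  apply: measurable_rVB; last exact: (adapted_mono (leqnSn t) (leqnn t) (@adapted_g i t)).
  rewrite (funext (vS i t)).
  apply: measurable_rVD; apply: measurable_rVZ; try exact: measurable_cst.
    exact: (adapted_mono (leqnSn t) (leqnn t) (@adapted_v i t)).
  have au : adapted t.+1 t (y t) by exact: (adapted_mono (leqnSn t) (leqnn t) (@adapted_y t)).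
  exact: (measurableT_comp (@measurable_gradF i) (@adapted_sample i t _ au)).
have EU : mean_le P (fun w => enorm (U w)) (compression_bound i t + drift i t).
  apply: mean_le_mono _ _ (mean_leD IH (mean_increment i t)).
    by apply: measurable_enorm; exact: measurable_rVB.
  move=> w; rewrite enorm_ge0/= (enormC (g i t w)) addrC.
  by rewrite -[U w](subrKA (v i t w)) ler_enormD.
pose h (p : Z i t.+1 * 'rV[R]_d) := enorm (@Cmp i t.+1 p.1 p.2 - p.2).
have mh : measurable_fun setT h.
  apply: measurable_enorm; apply: measurable_rVB; last exact: measurable_snd.
  exact: (@measurableC i t.+1).
(* The passage from second to first moments happens at a frozen [u], since for the random input only
   a first moment bound is at hand. *)
have Eh u : (\int[P]_w (h (zeta i t.+1 w, u))%:E <= (q * enorm u)%:E)%E.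
  suff [] : mean_le P (fun w => h (zeta i t.+1 w, u)) (q * enorm u) by [].
  have mzu : measurable_fun setT (fun w => h (zeta i t.+1 w, u)).
    apply: (measurableT_comp mh); apply: measurable_fun_pair => //.
  apply: mean_le_sqr => //; first by move=> w; exact: enorm_ge0.
    by rewrite mulr_ge0 ?enorm_ge0.
  split=> [|w|]; [exact: measurable_funX|exact: sqr_ge0|].
  by rewrite exprMn q_sqr; have := @hC i t u; rewrite unlock.
have indep : independent2 P (sigma_of (zeta i t.+1)) <<s past t.+1 t>>.
  exact: hzeta.
have mz : measurable_fun setT (zeta i t.+1) by [].
have := mean_le_freeze mz (measurable_adapted aU) (independent2_preimage indep aU) mh
  (fun p => enorm_ge0 _) Eh (mean_leZ q_ge0 EU).
congr (mean_le P _ _); apply/funext => w.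
by rewrite /h/= gS /U opprB addrCA addrA.
Qed.

(** * Descent and the weighted sum of gradient norms *)

Hypothesis L_ge0 : 0 <= L.
Hypothesis lipschitz_f : forall x y,
  enorm (grad (average_of fi) x - grad (average_of fi) y) <= L * enorm (x - y).
Hypothesis lbound_f : has_lbound (range (average_of fi)).

Let f := average_of fi.
Let finf := inf (range f).
Let Lh_avg := n%:R^-1 * \sum_i Lhi i.

Let diff_fi i z : differentiable (fi i) z.
Proof. by have [] := @smooth_fi i z. Qed.

Let diff_f z : differentiable f z.
Proof. exact: differentiable_average. Qed.

Let finf_le z : finf <= f z.
Proof. by apply: ge_inf => //; exists z. Qed.

(** The average of [M] stays inside the norm to keep the [1 / sqrt n] gain; the other two parts are
    averaged client by client. *)
Let direction_error t w := n%:R^-1 * (\sum_i enorm (g i t w - v i t w))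
  + enorm (avg (fun i => M i t w)) + 2 * b t ^+ 2 * (Lh_avg * gamma0 ^+ 2).

Let Lh_avg_ge0 : 0 <= Lh_avg.
Proof. by rewrite mulr_ge0 ?invr_ge0 ?ler0n// sumr_ge0. Qed.

Let direction_error_ge0 t w : 0 <= direction_error t w.
Proof.
have K0 : 0 <= Lh_avg * gamma0 ^+ 2 by rewrite mulr_ge0 ?sqr_ge0.
apply: addr_ge0; last by apply: mulr_ge0 => //; rewrite mulr_ge0 ?sqr_ge0.
apply: addr_ge0; last exact: enorm_ge0.
by rewrite mulr_ge0 ?invr_ge0 ?ler0n// sumr_ge0// => i _; exact: enorm_ge0.
Qed.

Let direction_error_le t w :
  enorm (avg (fun i => g i t.+1 w) - grad f (x t.+1 w)) <= direction_error t.+1 w.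
Proof.
pose N i := v i t.+1 w - grad (fi i) (x t.+1 w) - M i t.+1 w.
have -> : avg (fun i => g i t.+1 w) - grad f (x t.+1 w) =
    avg (fun i => g i t.+1 w - v i t.+1 w) + avg (fun i => M i t.+1 w) + avg N.
  rewrite grad_average//; rewrite /avg -scalerBr -!scalerDr -sumrB -!big_split/=.
  by congr (_ *: _); apply: eq_bigr => i _; rewrite /N; apply/rowP => j; rewrite !mxE; ring.
apply: le_trans (ler_enormD _ _) _; apply: lerD; last first.
  apply: le_trans (ler_enorm_avg _) _.
  have -> : 2 * b t.+1 ^+ 2 * (Lh_avg * gamma0 ^+ 2) =
      n%:R^-1 * \sum_i 2 * b t.+1 ^+ 2 * (Lhi i * gamma0 ^+ 2).
    by rewrite -mulr_sumr -mulr_suml /Lh_avg; ring.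
  rewrite ler_wpM2l ?invr_ge0 ?ler0n// ler_sum// => i _.
  exact: tracking_remainder.
apply: le_trans (ler_enormD _ _) _; rewrite lerD2r.
exact: ler_enorm_avg.
Qed.

(* In round 0 the direction may be arbitrarily bad (this error does not appear in
   [V_init] when [alpha = 1]); it costs at most twice the initial gap, because
   [gamma0 * enorm (grad f x0) <= f x0 - finf + L * gamma0 ^+ 2]. *)
Lemma sum_gradient_le w T :
  \sum_(t < T) gamma t * enorm (grad f (x t w)) <=
    3 * (f x0 - finf) + 3 * (L * gamma0 ^+ 2)
    + \sum_(t < T) (2 * gamma t * direction_error t w + L * gamma t ^+ 2).
Proof.
have LG t : 0 <= L * gamma t ^+ 2 by rewrite mulr_ge0 ?sqr_ge0.
have err0 t : 0 <= 2 * gamma t * direction_error t w + L * gamma t ^+ 2.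
  by rewrite addr_ge0// mulr_ge0// mulr_ge0.
have g00 : gamma 0 = gamma0 by rewrite gammaE schedule0 expr1n mulr1.
case: T => [|T].
  rewrite !big_ord0 addr0; have := finf_le x0; have := LG 0%N; rewrite g00; lra.
(* The gap at the last iterate is carried along so that the descent inequalities telescope. *)
suff : \sum_(t < T.+1) gamma t * enorm (grad f (x t w)) + (f (x T.+1 w) - finf) <=
    3 * (f x0 - finf) + 3 * (L * gamma0 ^+ 2)
    + \sum_(t < T.+1) (2 * gamma t * direction_error t w + L * gamma t ^+ 2).
  by apply: le_trans; rewrite lerDl subr_ge0.
elim: T => [|T IH].
  rewrite !big_ord1 g00 xg0.
  (* A virtual step along the exact gradient bounds [gamma0 |grad f x0|] by the initial gap plus
     [L gamma0^2]. The actual step raises [f] by at most the former plus [L gamma0^2]; adding up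
     gives the two constants 3. *)
  have := normalized_descent x0 (grad f x0) L_ge0 (ltW gamma0_gt0) diff_f lipschitz_f.
  rewrite subrr enorm0 mulr0 addr0 -/f; have := finf_le (x0 - gamma0 *: normalize (grad f x0)).
  have := smooth_upper_bound x0 (x 1%N w - x 0%N w) L_ge0 diff_f lipschitz_f.
  rewrite xg0 addrC subrK -/f.
  have s1 : enorm (x 1%N w - x0) <= gamma0 by rewrite -(xg0 w) -g00; exact: step_le.
  have : dotp (grad f x0) (x 1%N w - x0) <= gamma0 * enorm (grad f x0).
    apply: le_trans (dotp_le _ _) _; rewrite mulrC.
    by rewrite ler_wpM2r ?enorm_ge0.
  have : L * enorm (x 1%N w - x0) ^+ 2 <= L * gamma0 ^+ 2.
    by rewrite ler_wpM2l// lerXn2r ?nnegrE ?enorm_ge0 ?(ltW gamma0_gt0).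
  have := err0 0%N; rewrite g00.
  move: (2 * gamma0 * direction_error 0 w + L * gamma0 ^+ 2) => e.
  lra.
rewrite !(big_ord_recr T.+1)/=.
have := normalized_descent (x T.+1 w) (avg (fun i => g i T.+1 w)) L_ge0
  (gamma_ge0 T.+1) diff_f lipschitz_f.
rewrite -xS -/f.
have : 2 * gamma T.+1 * enorm (avg (fun i => g i T.+1 w) - grad f (x T.+1 w)) <=
    2 * gamma T.+1 * direction_error T.+1 w.
  by rewrite ler_wpM2l ?direction_error_le// mulr_ge0.
move: (\sum_(t < T.+1) _) (\sum_(t < T.+1) _) IH => s1 s2.
lra.
Qed.

Lemma measurable_iterate t : measurable_fun setT (x t).
Proof. exact: measurable_adapted (@adapted_x t). Qed.

Lemma measurable_grad_average : measurable_fun setT (grad f).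
Proof.
rewrite (_ : grad f = fun z => avg (fun i => grad (fi i) z)); last first.
  by apply/funext => z; rewrite grad_average.
exact: measurable_avg.
Qed.

Lemma mean_sum_gradient T :
  mean_le P (fun w => \sum_(t < T) gamma t * enorm (grad f (x t w)))
    (3 * (f x0 - finf) + 3 * (L * gamma0 ^+ 2) + \sum_(t < T) (2 * gamma t *
       (n%:R^-1 * (\sum_i compression_bound i t)
        + 2 * b t ^+ 2 * (sg / Num.sqrt n%:R)
        + 2 * b t ^+ 2 * (Lh_avg * gamma0 ^+ 2)) + L * gamma t ^+ 2)).
Proof.
have c0 : 0 <= 3 * (f x0 - finf) + 3 * (L * gamma0 ^+ 2).
  apply: addr_ge0; apply: mulr_ge0 => //; first by rewrite subr_ge0 finf_le.
  by rewrite mulr_ge0 ?sqr_ge0.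
have n0 : (0 : R) <= n%:R^-1 by rewrite invr_ge0 ler0n.
have Eerr t : mean_le P (direction_error t) (n%:R^-1 * (\sum_i compression_bound i t)
    + 2 * b t ^+ 2 * (sg / Num.sqrt n%:R) + 2 * b t ^+ 2 * (Lh_avg * gamma0 ^+ 2)).
  apply: mean_leD; last first.
    apply: mean_le_cst; apply: mulr_ge0; first by rewrite mulr_ge0 ?sqr_ge0.
    by rewrite mulr_ge0 ?sqr_ge0.
  apply: mean_leD; last exact: mean_avg_martingale.
  by apply: mean_leZ => //; apply: mean_le_sum => i; exact: mean_compression_error.
have Eround t : mean_le P
    (fun w => 2 * gamma t * direction_error t w + L * gamma t ^+ 2)
    (2 * gamma t * (n%:R^-1 * (\sum_i compression_bound i t)
        + 2 * b t ^+ 2 * (sg / Num.sqrt n%:R)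
        + 2 * b t ^+ 2 * (Lh_avg * gamma0 ^+ 2)) + L * gamma t ^+ 2).
  apply: mean_leD; first by apply: mean_leZ => //; rewrite mulr_ge0.
  by apply: mean_le_cst; rewrite mulr_ge0 ?sqr_ge0.
have := mean_leD (mean_le_cst P c0)
  (mean_le_sum (index_enum 'I_T) (fun t : 'I_T => Eround t)).
apply: mean_le_mono => [|w].
  apply: measurable_sum => t; apply: measurable_funM => //; apply: measurable_enorm.
  exact: (measurableT_comp measurable_grad_average (measurable_iterate t)).
rewrite sum_gradient_le andbT sumr_ge0// => t _.
by rewrite mulr_ge0 ?enorm_ge0.
Qed.

(** * Summation against the schedule *)

Let Lam T := \sum_(t < T) b t ^+ 7.

Let Lam_ge0 T : 0 <= Lam T.
Proof. by apply: sumr_ge0 => t _; rewrite exprn_ge0// schedule_ge0. Qed.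

Let drift_ge0 i t : 0 <= drift i t.
Proof.
apply: addr_ge0; last by rewrite mulr_ge0 ?ler0n ?enorm_ge0.
rewrite mulr_ge0 ?sqr_ge0//; apply: addr_ge0; [apply: addr_ge0|].
- by rewrite mulr_ge0.
- by rewrite mulr_ge0// ltW.
- by rewrite mulr_ge0// mulr_ge0 ?sqr_ge0.
Qed.

Let compression_bound_ge0 i t : 0 <= compression_bound i t.
Proof.
by elim: t => [|t IH] /=; [exact: enorm_ge0|rewrite mulr_ge0// addr_ge0].
Qed.

Let sum_drift i T : (0 < T)%N -> \sum_(t < T) gamma t * drift i t =
  gamma0 * (3 * sg + Li i * gamma0 + 2 * (Lhi i * gamma0 ^+ 2)) * Lam T
  + gamma0 * enorm (v0 i - grad (fi i) x0).
Proof.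
case: T => // T _; rewrite /drift.
under eq_bigr do rewrite mulrDr.
rewrite big_split/=; congr (_ + _).
  by rewrite /Lam mulr_sumr; apply: eq_bigr => t _; rewrite gammaE; ring.
rewrite big_ord_recl big1 ?addr0 => [|t _]; last by rewrite mul0r mulr0.
by rewrite gammaE schedule0 expr1n mulr1 mul1r.
Qed.

Let one_subq_gt0 : 0 < 1 - q.
Proof.
have /andP[a0 a1] := halpha.
rewrite subr_gt0 -(@ltr_pXn2r _ 2) ?nnegrE// q_sqr expr1n; lra.
Qed.

(** From [(1 - alpha / 2)^2 >= 1 - alpha] one gets [1 - q >= alpha / 2]; [alpha <= 1] then relaxes
    the bound to the power of [alpha] in the target rate. *)
Let invq_le : (1 - q)^-1 <= 2 * (alpha ^+ 2)^-1.
Proof.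
have /andP[a0 a1] := halpha.
have qa : q <= 1 - alpha / 2.
  rewrite -(@ler_pXn2r _ 2) ?nnegrE//; last lra.
  by rewrite q_sqr; have := sqr_ge0 alpha; lra.
have a20 : 0 < alpha ^+ 2 by rewrite exprn_gt0.
rewrite -[2]invrK -invfM lef_pV2 ?posrE ?mulr_gt0 ?invr_gt0//.
have : alpha ^+ 2 <= alpha by rewrite expr2 ler_piMr// ltW.
lra.
Qed.

Let q_le1 : q <= 1. Proof. by rewrite -subr_ge0 ltW. Qed.

(** The factor 2 of the descent inequality is included so that the initial terms carry exactly the
    coefficients of [V_init]. *)
Let sum_compression i T : (0 < T)%N ->
  2 * (\sum_(t < T) gamma t * compression_bound i t) <=
    2 * gamma0 / (1 - q) * enorm (g0 i - v0 i)
    + 2 * gamma0 * q / (1 - q) * enorm (v0 i - grad (fi i) x0)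
    + 4 * (alpha ^+ 2)^-1 * gamma0
      * (3 * sg + Li i * gamma0 + 2 * (Lhi i * gamma0 ^+ 2)) * Lam T.
Proof.
move=> T0; have := @sum_contraction R q (compression_bound i) gamma (drift i) T.
have gS' t : gamma t.+1 <= gamma t.
  rewrite !gammaE ler_pM2l// lerXn2r ?nnegrE ?schedule_ge0//.
  exact: schedule_nincr.
have AS t : compression_bound i t.+1 = q * (compression_bound i t + drift i t) by [].
move=> /(_ q_ge0 (@compression_bound_ge0 i) (@drift_ge0 i) gamma_ge0 gS' AS).
rewrite sum_drift//= gammaE schedule0 expr1n mulr1.
set Sg := \sum_(t < T) _; set a := enorm _; set u := enorm (v0 i - _).
set Di := 3 * sg + _ + _ => h.
have D0 : 0 <= gamma0 * Di * Lam T.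
  rewrite mulr_ge0// mulr_ge0//; first exact: ltW.
  apply: addr_ge0; [apply: addr_ge0|].
  - by rewrite mulr_ge0.
  - by rewrite mulr_ge0// ltW.
  - by rewrite mulr_ge0// mulr_ge0 ?sqr_ge0.
have {h} : Sg <= (gamma0 * a + q * (gamma0 * Di * Lam T + gamma0 * u)) / (1 - q).
  by rewrite ler_pdivlMr// mulrC.
have : q / (1 - q) * (gamma0 * Di * Lam T) <= 2 * (alpha ^+ 2)^-1 * (gamma0 * Di * Lam T).
  rewrite ler_wpM2r//; apply: le_trans invq_le.
  by rewrite ler_piMl// invr_ge0 ltW.
move: ((1 - q)^-1) ((alpha ^+ 2)^-1) => k a2; lra.
Qed.

(** The constant 12 is the largest coefficient: [4 * 3] for [sg / alpha^2], and [8 + 4] for the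
    Hessian term, whose uncompressed part is absorbed by [1 <= 1 / alpha^2]. *)
Lemma rate_bound T : (0 < T)%N ->
  3 * (f x0 - finf) + 3 * (L * gamma0 ^+ 2) + \sum_(t < T) (2 * gamma t *
       (n%:R^-1 * (\sum_i compression_bound i t)
        + 2 * b t ^+ 2 * (sg / Num.sqrt n%:R)
        + 2 * b t ^+ 2 * (Lh_avg * gamma0 ^+ 2)) + L * gamma t ^+ 2)
  <= 12 * (1 + Lam T) * (V_init f fi alpha gamma0 x0 g0 v0
       + gamma0 * (sg * ((Num.sqrt n%:R)^-1 + (alpha ^+ 2)^-1))
       + gamma0 * (gamma0 * (L + (n%:R^-1 * \sum_i Li i) / alpha ^+ 2))
       + gamma0 * (gamma0 ^+ 2 * (Lh_avg / alpha ^+ 2))).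
Proof.
move=> T0; have n0 : (0 : R) <= n%:R^-1 by rewrite invr_ge0 ler0n.
rewrite /V_init -/q -/finf.
set av := n%:R^-1 * \sum_i enorm (g0 i - v0 i).
set au := n%:R^-1 * \sum_i enorm (v0 i - grad (fi i) x0).
set Lb := n%:R^-1 * \sum_i Li i; set a2 := (alpha ^+ 2)^-1.
set r := (Num.sqrt n%:R)^-1.
have Sc : n%:R^-1 * \sum_i 2 * (\sum_(t < T) gamma t * compression_bound i t) <=
    2 * gamma0 / (1 - q) * av + 2 * gamma0 * q / (1 - q) * au
    + 4 * a2 * gamma0 * (3 * sg + Lb * gamma0 + 2 * (Lh_avg * gamma0 ^+ 2)) * Lam T.
  apply: le_trans (ler_wpM2l n0 (ler_sum _ (fun i _ => @sum_compression i T T0))) _.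
  rewrite le_eqVlt; apply/orP; left; apply/eqP.
  rewrite /av /au /Lb /Lh_avg -/a2.
  have -> : \sum_i (2 * gamma0 / (1 - q) * enorm (g0 i - v0 i) +
       2 * gamma0 * q / (1 - q) * enorm (v0 i - grad (fi i) x0) +
       4 * a2 * gamma0 * (3 * sg + Li i * gamma0 + 2 * (Lhi i * gamma0 ^+ 2)) * Lam T) =
     2 * gamma0 / (1 - q) * (\sum_i enorm (g0 i - v0 i)) +
     2 * gamma0 * q / (1 - q) * (\sum_i enorm (v0 i - grad (fi i) x0)) +
     4 * a2 * gamma0 * ((\sum_(i < n) 1) * (3 * sg) + (\sum_i Li i) * gamma0
       + 2 * ((\sum_i Lhi i) * gamma0 ^+ 2)) * Lam T.
    elim: (index_enum _) => [|i s IH]; first by rewrite !big_nil; ring.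
    by rewrite !big_cons IH; ring.
  rewrite sumr_const card_ord; move: ((1 - q)^-1) => k.
  by field; rewrite pnatr_eq0 -lt0n.
have split_sum : \sum_(t < T) (2 * gamma t *
       (n%:R^-1 * (\sum_i compression_bound i t)
        + 2 * b t ^+ 2 * (sg / Num.sqrt n%:R)
        + 2 * b t ^+ 2 * (Lh_avg * gamma0 ^+ 2)) + L * gamma t ^+ 2) <=
    n%:R^-1 * (\sum_i 2 * (\sum_(t < T) gamma t * compression_bound i t))
    + 4 * gamma0 * (sg * r) * Lam T + 4 * gamma0 * (Lh_avg * gamma0 ^+ 2) * Lam T
    + L * gamma0 ^+ 2 * Lam T.
  have -> : n%:R^-1 * (\sum_i 2 * (\sum_(t < T) gamma t * compression_bound i t)) =
      \sum_(t < T) 2 * gamma t * (n%:R^-1 * (\sum_i compression_bound i t)).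
    rewrite -mulr_sumr exchange_big/= !mulr_sumr; apply: eq_bigr => t _.
    by rewrite -mulr_sumr; ring.
  rewrite /Lam !mulr_sumr -!big_split/=; apply: ler_sum => t _.
  have b10 := schedule_exp_le (R := R) t (isT : (7 <= 10)%N).
  have h : L * gamma0 ^+ 2 * b t ^+ 10 <= L * gamma0 ^+ 2 * b t ^+ 7.
    by rewrite ler_wpM2l// mulr_ge0 ?sqr_ge0.
  by rewrite gammaE -/r; lra.
apply: le_trans (lerD (lexx _) split_sum) _.
apply: le_trans (lerD (lexx _) (lerD (lerD (lerD Sc (lexx _)) (lexx _)) (lexx _))) _.
have av0 : 0 <= 2 * gamma0 / (1 - q) * av.
  rewrite mulr_ge0 ?divr_ge0 ?(ltW one_subq_gt0) ?mulr_ge0 ?(ltW gamma0_gt0)//.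
  by apply: sumr_ge0 => i _; exact: enorm_ge0.
have au0 : 0 <= 2 * gamma0 * q / (1 - q) * au.
  rewrite mulr_ge0 ?divr_ge0 ?(ltW one_subq_gt0) ?mulr_ge0 ?(ltW gamma0_gt0)//.
  by apply: sumr_ge0 => i _; exact: enorm_ge0.
have De0 : 0 <= f x0 - finf by rewrite subr_ge0 finf_le.
have a21 : 1 <= a2.
  have /andP[a0 a1] := halpha.
  by rewrite /a2 invf_ge1 ?exprn_gt0// exprn_ile1// ltW.
have Lb0 : 0 <= Lb by rewrite mulr_ge0// sumr_ge0.
have r0 : 0 <= r by rewrite invr_ge0 sqrtr_ge0.
rewrite -/a2 -/r; move: (Lam T) (Lam_ge0 T) => l l0.
move: (2 * gamma0 / (1 - q) * av) (2 * gamma0 * q / (1 - q) * au) av0 au0 => Va Vu Va0 Vu0.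
move: (f x0 - finf) De0 => De De0.
clear Sc split_sum; clearbody a2 Lb r.
(* What remains is a comparison of coefficients: the facts below supply the sign of each product
   involved, with and without the factor [l]. *)
have c0 := ltW gamma0_gt0.
have p1 : 0 <= gamma0 * sg * r by rewrite mulr_ge0// mulr_ge0.
have p2 : 0 <= gamma0 * sg * a2 by rewrite mulr_ge0 ?(le_trans ler01 a21)// mulr_ge0.
have p3 : 0 <= gamma0 ^+ 2 * L by rewrite mulr_ge0 ?sqr_ge0.
have p4 : 0 <= gamma0 ^+ 2 * Lb * a2.
  by rewrite mulr_ge0 ?(le_trans ler01 a21)// mulr_ge0 ?sqr_ge0.
have p5 : 0 <= gamma0 ^+ 3 * Lh_avg by rewrite mulr_ge0 ?exprn_ge0.
have p6 : gamma0 ^+ 3 * Lh_avg <= gamma0 ^+ 3 * Lh_avg * a2 by rewrite ler_peMr.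
have l1 := mulr_ge0 l0 p1; have l2 := mulr_ge0 l0 p2; have l3 := mulr_ge0 l0 p3.
have l4 := mulr_ge0 l0 p4; have l5 := mulr_ge0 l0 p5; have l6 := ler_wpM2l l0 p6.
have l7 := mulr_ge0 l0 De0; have l8 := mulr_ge0 l0 Va0; have l9 := mulr_ge0 l0 Vu0.
lra.
Qed.

End ef21_igt_analysis.

(** * The concrete trajectory and the final rate *)

Section smoothed_noise.
Context {R : realType} {d : nat} {Om : Type}.

(** Supplies the process [M] of the analysis: the noise passed through the momentum filter of [v],
    started at 0. *)
Fixpoint smoothed_noise (eta : nat -> R) (s : nat -> Om -> 'rV[R]_d) (t : nat)
    (w : Om) : 'rV[R]_d :=
  if t is t'.+1 then (1 - eta t') *: smoothed_noise eta s t' w + eta t' *: s t' w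
  else 0.

End smoothed_noise.

Theorem theorem2 (R : realType) :
  exists C p : R, 0 < C /\ 0 <= p /\
  forall (d n : nat) (hd : (0 < d)%N) (hn : (0 < n)%N)
    (* sample spaces and laws, compressor seed spaces *)
    (dX dZ dO : measure_display)
    (Xi : 'I_n -> measurableType dX) (D : forall i, probability (Xi i) R)
    (Z : 'I_n -> nat -> measurableType dZ)
    (* objective *)
    (F : forall i, 'rV[R]_d -> Xi i -> R) (fi : 'I_n -> 'rV[R]_d -> R)
    (hFmeas : forall i, measurable_fun setT
       (fun p : 'rV[R]_d * Xi i => F i p.1 p.2))
    (hfi : forall i x, ('E_(D i)[F i x] = (fi i x)%:E)%E)
    (hFsmooth : forall i z, twice_differentiable (fun x => F i x z))
    (hfismooth : forall i, twice_differentiable (fi i)),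
  let f := fun x => n%:R^-1 * \sum_i fi i x in
  forall
    (* compressors and the underlying probability space *)
    (Cmp : forall i t, Z i t -> 'rV[R]_d -> 'rV[R]_d)
    (hCmeas : forall i t, measurable_fun setT
       (fun p : Z i t * 'rV[R]_d => Cmp i t p.1 p.2))
    (Om : measurableType dO) (P : probability Om R)
    (xi : forall i, nat -> {RV P >-> Xi i})
    (zeta : forall i t, {RV P >-> Z i t})
    (hxi : fresh_samples D xi zeta)
    (hzeta : fresh_compressors xi zeta)
    (* (i) *)
    (alpha : R) (halpha : 0 < alpha <= 1)
    (hC : forall i t,
       contractive P alpha (fun w => Cmp i t.+1 (zeta i t.+1 w)))
    (* (ii) *)
    (hinf : has_lbound (range f))
    (* (iii), (iv) *)
    (Li : 'I_n -> R) (hLi : forall i, 0 < Li i)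
    (hgradi : forall i x y,
       enorm (grad (fi i) x - grad (fi i) y) <= Li i * enorm (x - y))
    (L : R) (hL : 0 < L)
    (hgrad : forall x y, enorm (grad f x - grad f y) <= L * enorm (x - y))
    (* (v), (vi) *)
    (Lhi : 'I_n -> R) (hLhi : forall i, 0 < Lhi i)
    (hhessi : forall i x y,
       specnorm (hess (fi i) x - hess (fi i) y) <= Lhi i * enorm (x - y))
    (Lh : R) (hLh : 0 < Lh)
    (hhess : forall x y, specnorm (hess f x - hess f y) <= Lh * enorm (x - y))
    (* (vii) *)
    (sg sh : R) (hsg : 0 <= sg) (hsh : 0 <= sh)
    (hgmean : forall i x,
       has_mean (D i) (fun z => grad (fun x => F i x z) x) (grad (fi i) x))
    (hgvar : forall i x,
       ('E_(D i)[fun z =>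
           (enorm (grad (fun x => F i x z) x - grad (fi i) x) ^+ 2)%R]
          <= (sg ^+ 2)%:E)%E)
    (hhmean : forall i x,
       has_mean (D i) (fun z => hess (fun x => F i x z) x) (hess (fi i) x))
    (hhvar : forall i x,
       ('E_(D i)[fun z =>
           (specnorm (hess (fun x => F i x z) x - hess (fi i) x) ^+ 2)%R]
          <= (sh ^+ 2)%:E)%E)
    (* inputs of the algorithm *)
    (x0 : 'rV[R]_d) (g0 v0 : 'I_n -> 'rV[R]_d)
    (gamma0 : R) (hgamma0 : 0 < gamma0),
  let eta := fun t : nat => (2 / (t%:R + 2)) `^ (4 / 7) in
  let gamma := fun t : nat => gamma0 * (2 / (t%:R + 2)) `^ (5 / 7) in
  let x := fun (t : nat) (w : Om) =>
    st_x (ef21_igt F Cmp gamma eta x0 g0 v0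
            (fun i s => xi i s w) (fun i s => zeta i s w) t) in
  let V0 := V_init f fi alpha gamma0 x0 g0 v0 in
  let B1 := L + (n%:R^-1 * \sum_i Li i) / alpha ^+ 2 in
  let B2 := Lh + (n%:R^-1 * \sum_i Lhi i) / alpha ^+ 2 in
  forall (T : nat) (hT : (1 <= T)%N)
    (* the index of the random output iterate *)
    (tau : {RV P >-> nat})
    (htau : forall t, (t < T)%N ->
       P (tau @^-1` [set t]) = (gamma t / \sum_(s < T) gamma s)%:E)
    (htau_indep : independent2 P (sigma_of tau)
       <<s [set A | exists2 t, (t < T)%N & sigma_of (x t) A] >>),
  ('E_P[fun w => enorm (grad f (x (tau w) w))] <=
    (C * (1 + ln (T%:R + 1)) `^ p *
     ((V0 / gamma0 + sg * ((Num.sqrt n%:R)^-1 + (alpha ^+ 2)^-1)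
       + gamma0 * B1 + gamma0 ^+ 2 * B2) / T%:R `^ (2 / 7)))%:E)%E.
Proof.
(* 24 is the 12 of [rate_bound] doubled by [sum_schedule7_le]; one logarithm appears, hence the
   power 1. *)
exists 24, 1; split; [by []|split; [by []|]].
move=> d n hd hn dX dZ dO Xi D Z F fi hFmeas hfi hFsmooth hfismooth f Cmp hCmeas Om P.
move=> xi zeta hxi hzeta alpha halpha hC hinf Li hLi hgradi L hL hgrad Lhi hLhi hhessi.
move=> Lh hLh hhess sg sh hsg hsh hgmean hgvar hhmean hhvar x0 g0 v0 gamma0 hgamma0.
move=> eta gamma x V0 B1 B2 T hT tau htau htau_indep.
pose st t w := ef21_igt F Cmp gamma eta x0 g0 v0
  (fun i s => xi i s w) (fun i s => zeta i s w) t.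
pose g i t w := st_g (st t w) i; pose v i t w := st_v (st t w) i.
pose y t w := x t.+1 w + ((1 - eta t) / eta t) *: (x t.+1 w - x t w).
pose noise i (u : 'rV[R]_d) z := grad (fun x => F i x z) u - grad (fi i) u.
pose M i := smoothed_noise eta (fun t w => noise i (y t w) (xi i t.+1 w)).
have etaE t : eta t = schedule t ^+ 4 by rewrite -powR_schedule.
have gammaE t : gamma t = gamma0 * schedule t ^+ 5 by rewrite -powR_schedule.
have Li0 i := ltW (hLi i); have Lhi0 i := ltW (hLhi i).
(* The recursions hold by computation on one step of [ef21_igt]; the analysis receives only these
   equations and the initial values. *)
have xS t w : x t.+1 w = x t w - gamma t *: normalize (avg (fun i => g i t w)) by [].
have yE t w : y t w = x t.+1 w + ((1 - eta t) / eta t) *: (x t.+1 w - x t w) by [].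
have vS i t w : v i t.+1 w = (1 - eta t) *: v i t w
    + eta t *: grad (fun x => F i x (xi i t.+1 w)) (y t w) by [].
have gS i t w : g i t.+1 w = g i t w
    + Cmp i t.+1 (zeta i t.+1 w) (v i t.+1 w - g i t w) by [].
have MS i t w : M i t.+1 w = (1 - eta t) *: M i t w
    + eta t *: noise i (y t w) (xi i t.+1 w) by [].
have mx t : measurable_fun setT (x t).
  exact: (measurable_iterate (P := P) hFmeas hfi hFsmooth hfismooth hCmeas
    (fun w => erefl : x 0%N w = x0) (fun i w => erefl : g i 0%N w = g0 i)
    (fun i w => erefl : v i 0%N w = v0 i) (fun i w => erefl : M i 0%N w = 0)
    xS yE vS gS MS).
have Eg := mean_sum_gradient hn hFmeas hfi hFsmooth hfismooth hCmeas hxi hzeta halpha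
  hC Li0 hgradi Lhi0 hhessi hsg hgmean hgvar hgamma0 gammaE etaE
  (fun w => erefl : x 0%N w = x0) (fun i w => erefl : g i 0%N w = g0 i)
  (fun i w => erefl : v i 0%N w = v0 i) (fun i w => erefl : M i 0%N w = 0)
  xS yE vS gS MS (ltW hL) hgrad hinf T.
have rate := rate_bound (fi := fi) x0 g0 v0 hn halpha Li0 Lhi0 hsg hgamma0 gammaE
  (ltW hL) hinf hT.
have {Eg rate} := mean_leW rate Eg.
set lam := \sum_(_ < T) _; set Q := (V0 / gamma0 + _ + _ + _) => EW.
set Gam := \sum_(s < T) gamma s in htau.
have gamma_gt0 t : 0 < gamma t by rewrite gammaE mulr_gt0// exprn_gt0// schedule_gt0.
have T0 : (0 : R) < T%:R by rewrite ltr0n.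
have Tp : 0 < T%:R `^ (2 / 7) :> R by rewrite powR_gt0.
have Gam_ge : gamma0 * T%:R `^ (2 / 7) <= Gam.
  rewrite /Gam; under eq_bigr do rewrite gammaE.
  by rewrite -mulr_sumr ler_pM2l// sum_schedule5_ge.
have Gam0 : 0 < Gam by apply: lt_le_trans Gam_ge; rewrite mulr_gt0.
have a20 : 0 <= (alpha ^+ 2)^-1 by rewrite invr_ge0 sqr_ge0.
have nV0 : (0 : R) <= n%:R^-1 by rewrite invr_ge0 ler0n.
have B10 : 0 <= B1.
  apply: addr_ge0; first exact: ltW.
  by rewrite mulr_ge0// mulr_ge0// sumr_ge0.
have B20 : 0 <= B2.
  apply: addr_ge0; first exact: ltW.
  by rewrite mulr_ge0// mulr_ge0// sumr_ge0.
have s0 : 0 <= sg * ((Num.sqrt n%:R)^-1 + (alpha ^+ 2)^-1).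
  by rewrite mulr_ge0// addr_ge0// invr_ge0 sqrtr_ge0.
have V00 : 0 <= V0.
  have q1 : 0 <= 1 - Num.sqrt (1 - alpha).
    case/andP: halpha => a0 a1.
    by rewrite subr_ge0 -[leRHS]sqrtr1 ler_sqrt//; lra.
  have avg0 (u : 'I_n -> 'rV[R]_d) : 0 <= n%:R^-1 * \sum_i enorm (u i).
    by rewrite mulr_ge0// sumr_ge0// => i _; exact: enorm_ge0.
  have c0 : 0 <= 2 * gamma0 by rewrite mulr_ge0// ltW.
  apply: addr_ge0; last first.
    by apply: mulr_ge0 => //; rewrite divr_ge0// mulr_ge0// sqrtr_ge0.
  apply: addr_ge0; last by apply: mulr_ge0 => //; rewrite divr_ge0.
  by rewrite subr_ge0; apply: ge_inf => //; exists x0.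
have Q0 : 0 <= Q.
  have c0 := ltW hgamma0.
  have h1 : 0 <= V0 / gamma0 by rewrite divr_ge0.
  have h2 : 0 <= gamma0 * B1 by rewrite mulr_ge0.
  have h3 : 0 <= gamma0 ^+ 2 * B2 by rewrite mulr_ge0// sqr_ge0.
  by rewrite /Q; lra.
have lnT : 0 <= ln (T%:R + 1) :> R by rewrite ln_ge0// lerDr ltW.
have lam_le : 12 * (1 + lam) <= 24 * (1 + ln (T%:R + 1)).
  have := @sum_schedule7_le R T; rewrite -/lam; lra.
have {}EW : mean_le P (fun w => \sum_(t < T) gamma t * enorm (grad f (x t w)))
    (24 * (1 + ln (T%:R + 1)) * (gamma0 * Q)).
  apply: mean_leW EW; apply: ler_pM => //.
  - by rewrite mulr_ge0// addr_ge0// sumr_ge0// => t _; rewrite exprn_ge0// schedule_ge0.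
  - have c0 := ltW hgamma0.
    set h := n%:R^-1 * \sum_i Lhi i.
    have h0 : 0 <= h by rewrite mulr_ge0// sumr_ge0.
    apply: addr_ge0; last exact: mulr_ge0 c0 (mulr_ge0 (sqr_ge0 _) (mulr_ge0 h0 a20)).
    apply: addr_ge0; last exact: mulr_ge0 c0 (mulr_ge0 c0 B10).
    exact: addr_ge0 V00 (mulr_ge0 c0 s0).
  - have hB2 : gamma0 * (gamma0 ^+ 2 * (n%:R^-1 * (\sum_i Lhi i) / alpha ^+ 2))
        <= gamma0 * (gamma0 ^+ 2 * B2).
      by rewrite ler_pM2l// ler_wpM2l ?sqr_ge0// lerDr ltW.
    have VE : gamma0 * (V0 / gamma0) = V0 by rewrite mulrCA divff ?mulr1// gt_eqF.
    rewrite /Q [leRHS]mulrDr [X in _ <= X + _]mulrDr [X in _ <= X + _ + _]mulrDr VE.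
    apply: lerD hB2.
    exact: lexx.
have GamV0 : 0 <= Gam^-1 by rewrite invr_ge0 ltW.
have Eavg := mean_leZ GamV0 EW.
have mgf : measurable_fun setT (fun u => enorm (grad f u)).
  exact: measurable_enorm (measurable_grad_average hFmeas hfi hfismooth).
have p0 t : 0 <= gamma t / Gam by rewrite divr_ge0 ?ltW.
have p1 : \sum_(t < T) gamma t / Gam = 1 by rewrite -mulr_suml divff// gt_eqF.
rewrite unlock.
(* Division by [Gam] has turned the stepsize weights into the law of [tau]. *)
apply: le_trans (mean_le_random_index (p := fun t => gamma t / Gam) mx mgf
  (fun _ => enorm_ge0 _) p0 p1 htau htau_indep
  (c := Gam^-1 * (24 * (1 + ln (T%:R + 1)) * (gamma0 * Q))) _) _.
  congr (mean_le P _ _): Eavg; apply/funext => w.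
  by rewrite mulr_sumr; apply: eq_bigr => t _; rewrite mulrA (mulrC Gam^-1).
rewrite lee_fin powRr1; last by rewrite addr_ge0.
have -> : 24 * (1 + ln (T%:R + 1)) * (Q / T%:R `^ (2 / 7)) =
    (gamma0 * T%:R `^ (2 / 7))^-1 * (24 * (1 + ln (T%:R + 1)) * (gamma0 * Q)).
  by field; rewrite !gt_eqF.
apply: ler_wpM2r.
  by rewrite !mulr_ge0// ?addr_ge0// ltW.
by rewrite lef_pV2 ?posrE// mulr_gt0.
Qed.
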